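(* Let $r\geq 3$ be an integer. Then for all $\delta>0$ there exist $M$ and $\beta>0$ such that for all $n>M$, $$\frac{|M_r(n)\setminus C_r^{\delta}(n)|}{|M_r(n)|}\leq \frac{|M_r(n)\setminus C_r^{\delta}(n)|}{\lceil\frac{r+1}{2}\rceil^{\binom n2}}\leq 2^{-\beta n^2}.$$
   Context: $[r]=\{1,\ldots,r\}$, $[i,j]=\{i,\ldots,j\}$. An $r$-graph is a pair $G=(V,c)$ with $c:\binom{V}{2}\to 2^{[r]}$; simple means $|c(e)|\leq1$ for all $e$, complete means $c(e)\neq\emptyset$ for all $e$; for simple complete $G$, $d^G(x,y)$ is the unique element of $c(xy)$. $M_r(n)$ is the set of simple complete $r$-graphs $([n],c)$ satisfying $d(x,z)\leq d(x,y)+d(y,z)$ for all pairwise distinct $x,y,z$. Definition of $C_r(n)$: if $r\geq4$ is even, $C_r(n)$ is the set of simple complete $r$-graphs $([n],c)$ with $c(e)\subseteq[\frac r2,r]$ for all $e$; if $r\geq3$ is odd, $C_r(n)$ is the set of simple complete $r$-graphs $G=([n],c)$ for which there is a partition $V_1\cup\cdots\cup V_t$ of $[n]$ such that $c(xy)\subseteq[\frac{r-1}2,r-1]$ whenever $x,y$ lie in a common part $V_i$, and $c(xy)\subseteq[\frac{r+1}2,r]$ whenever $x\in V_i,y\in V_j$ with $i\neq j$. Two $r$-graphs $(V,c)$, $(V,c')$ on the same vertex set are $\delta$-close if $|\{e\in\binom V2: c(e)\neq c'(e)\}|\leq\delta|V|^2$. $C_r^\delta(n)$ is the set of $G\in M_r(n)$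 that are $\delta$-close to some element of $C_r(n)$. *)

(* Defs.v *)
From mathcomp Require Import all_boot all_order all_algebra.
From mathcomp Require Import reals exp.

Set Implicit Arguments.
Unset Strict Implicit.
Unset Printing Implicit Defensive.

Import Order.TTheory GRing.Theory Num.Theory.

(* The colour set [r] = {1, ..., r} is encoded by 'I_r, the ordinal i standing
   for the colour i.+1; the vertex set [n] is encoded by 'I_n. *)

Definition edge (V : finType) := {e : {set V} | #|e| == 2}.

Definition r_graph (r : nat) (V : finType) := {ffun edge V -> {set 'I_r}}.

Section RGraph.

Variables (r : nat) (V : finType).
Implicit Types G : r_graph r V.

(* c(xy); the value set0 at x = y, where xy is not an edge, is a dummy. *)
Definition colors G (x y : V) : {set 'I_r} :=
  if @insub _ _ (edge V) [set x; y] is Some e then G e else set0.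

Definition simple_graph G : bool := [forall e, #|G e| <= 1].

Definition complete_graph G : bool := [forall e, G e != set0].

(* The unique element of c(xy) when G is simple and complete and x != y. *)
Definition dG G (x y : V) : nat :=
  if [pick i in colors G x y] is Some i then i.+1 else 0.

Definition metric_graph G : bool :=
  [forall x, forall y, forall z,
    [&& x != y, y != z & x != z] ==> (dG G x z <= dG G x y + dG G y z)].

Definition color_itv (a b : nat) : {set 'I_r} := [set i : 'I_r | a <= i.+1 <= b].

Definition delta_close (R : realType) (delta : R) G G' : bool :=
  (#|[set e | G e != G' e]|%:R <= delta * #|V|%:R ^+ 2)%R.

Definition even_extremal G : bool :=
  [forall e, G e \subset color_itv r./2 r].

(* For odd r, r./2 = (r - 1) / 2 and r.+1./2 = (r + 1) / 2. *)
Definition odd_extremal G : bool :=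
  [exists P : {set {set V}},
    [&& partition P [set: V],
        [forall A in P, forall x in A, forall y in A,
          (x != y) ==> (colors G x y \subset color_itv r./2 r.-1)] &
        [forall A in P, forall B in P, (A != B) ==>
          [forall x in A, forall y in B,
            colors G x y \subset color_itv r.+1./2 r]]]].

End RGraph.

Definition Mr (r n : nat) : {set r_graph r 'I_n} :=
  [set G | [&& simple_graph G, complete_graph G & metric_graph G]].

Definition Cr (r n : nat) : {set r_graph r 'I_n} :=
  [set G | [&& simple_graph G, complete_graph G
             & if odd r then odd_extremal G else even_extremal G]].

Definition Cr_close (R : realType) (delta : R) (r n : nat) :
    {set r_graph r 'I_n} :=
  [set G in Mr r n | [exists G' in Cr r n, delta_close delta G G']].

(* Main.v *)
Require Import Defs.
From mathcomp Require Import all_boot all_order all_algebra.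
From mathcomp Require Import reals sequences exp.
From mathcomp Require Import zify ring lra.

(* Write m = floor(r/2) + 1, the ceiling of (r+1)/2.  By weak (Frieze-Kannan)
   regularity, each metric graph agrees, up to few edges, with a template: a step
   assignment of colour sets T(x,y), constant on the cells of a partition cut out
   by boundedly many sets, in which few triples violate the triangle inequality.
   There are only 2^O(n) templates, and the number of graphs near T is governed by
   the product of the sizes |T(x,y)|.

   If |T(x,y)| > m and the triple x, y, z is metric, then |T(x,z)| + |T(y,z)| <= 2m.
   So deleting the two ends of an edge with more than m colours loses at most a
   factor m^2 per remaining vertex; hence the product is exponentially smaller than
   m^(n choose 2) unless almost all the sets have size exactly m.  In that case
   metric triples force T, up to few edges, into the extremal form: [r/2,r]
   everywhere for even r; for odd r, two adjacent edges different from
   [(r+1)/2,r] force [(r-1)/2,r-1] on the whole triangle, so the latter edges form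
   an almost transitive relation, which is close to an equivalence relation.
   Graphs that are not close to extremal thus lie near lossy templates only. *)

Set Implicit Arguments.
Unset Strict Implicit.
Unset Printing Implicit Defensive.

Import Order.TTheory GRing.Theory Num.Theory.
Local Open Scope ring_scope.

(** * Averages over the cells of a partition *)

Section CellAverage.

Variables (R : realFieldType) (W : finType).

Definition measurable_wrt (J T : Type) (P : W -> J) (k : W -> T) :=
  forall w w', P w = P w' -> k w = k w'.

(** Conditional expectation of [h] given the partition of [W] into fibres of [P]. *)
Definition cell_avg (J : eqType) (P : W -> J) (h : W -> R) (w : W) : R :=
  (\sum_(w' | P w' == P w) h w') / #|[pred w' | P w' == P w]|%:R.

Variables (J : eqType) (P : W -> J).
Implicit Types h k : W -> R.

Lemma cell_avg_measurable h : measurable_wrt P (cell_avg P h).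
Proof. by move=> w w' e; rewrite /cell_avg e. Qed.

Lemma cell_card_gt0 w : 0 < #|[pred w' | P w' == P w]|%:R :> R.
Proof. by rewrite ltr0n; apply/card_gt0P; exists w; rewrite inE. Qed.

(** Averaging spreads each value of [h] evenly over its cell, where [k] is constant, so the pairing
    with [k] does not change. *)
Lemma cell_avg_adjoint h k : measurable_wrt P k ->
  \sum_w cell_avg P h w * k w = \sum_w h w * k w.
Proof.
move=> mk; rewrite /cell_avg.
under eq_bigr do rewrite -mulrA mulr_suml.
rewrite (exchange_big_dep predT) //=; apply: eq_bigr => w' _.
rewrite -mulr_sumr; congr (_ * _).
transitivity (\sum_(w | P w == P w') k w' / #|[pred u | P u == P w']|%:R).
  apply: eq_big => [w | w /eqP e]; first by rewrite eq_sym.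
  by rewrite e mulrC (mk w' w).
rewrite sumr_const -[LHS]mulr_natr -mulrA mulVf ?mulr1 //.
by rewrite gt_eqF ?cell_card_gt0.
Qed.

Lemma cell_avg_ge0 h w : (forall v, 0 <= h v) -> 0 <= cell_avg P h w.
Proof. by move=> h0; rewrite /cell_avg divr_ge0 ?sumr_ge0. Qed.

Lemma cell_avg_le1 h w : (forall v, h v <= 1) -> cell_avg P h w <= 1.
Proof.
move=> h1; rewrite /cell_avg ler_pdivrMr ?cell_card_gt0 // mul1r.
apply: le_trans (_ : \sum_(w' | P w' == P w) 1 <= _); first exact: ler_sum.
by rewrite sumr_const.
Qed.

(** The set of low density is a union of cells, so [h] may be replaced on it by its average, which
    is below [eta] there. *)
Lemma low_density_mass h (eta : R) : 0 <= eta ->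
  \sum_(w | cell_avg P h w < eta) h w <= eta * #|W|%:R.
Proof.
move=> eta0; pose k w : R := (cell_avg P h w < eta)%R%:R.
have mk : measurable_wrt P k by move=> w w' e; rewrite /k (cell_avg_measurable h e).
rewrite big_mkcond /=.
have -> : \sum_w (if cell_avg P h w < eta then h w else 0) = \sum_w h w * k w.
  by apply: eq_bigr => w _; rewrite /k; case: ifP => _; rewrite ?mulr1 ?mulr0.
rewrite -cell_avg_adjoint //.
apply: le_trans (_ : \sum_(w : W) eta <= _); last first.
  by rewrite sumr_const -[X in X <= _]mulr_natr.
apply: ler_sum => w _; rewrite /k; case: (ltP (cell_avg P h w) eta) => /= c.
  by rewrite mulr1 ltW.
by rewrite mulr0.
Qed.

Definition energy (h : W -> R) : R := \sum_w cell_avg P h w ^+ 2.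

Lemma energy_le h : (forall v, 0 <= h v <= 1) -> energy h <= #|W|%:R.
Proof.
move=> h01; rewrite /energy.
apply: le_trans (_ : \sum_(w : W) 1 <= _); last by rewrite sumr_const.
apply: ler_sum => w _; rewrite expr_le1 //.
  by apply: cell_avg_le1 => v; case/andP: (h01 v).
by apply: cell_avg_ge0 => v; case/andP: (h01 v).
Qed.

End CellAverage.

(** Pythagoras: the average over the coarser partition is the orthogonal projection of the finer
    one. *)
Lemma energy_refine (R : realFieldType) (W : finType) (J K : eqType)
    (P : W -> J) (Q : W -> K) (h : W -> R) : measurable_wrt Q P ->
  energy Q h = energy P h + \sum_w (cell_avg Q h w - cell_avg P h w) ^+ 2.
Proof.
move=> QP; have mP : measurable_wrt Q (cell_avg P h).
  by move=> w w' /QP /cell_avg_measurable.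
have e1 : \sum_w cell_avg Q h w * cell_avg P h w = \sum_w cell_avg P h w ^+ 2.
  rewrite cell_avg_adjoint // -(cell_avg_adjoint (P := P)) //.
  exact: cell_avg_measurable.
have -> : \sum_w (cell_avg Q h w - cell_avg P h w) ^+ 2
  = energy Q h - 2 * (\sum_w cell_avg Q h w * cell_avg P h w) + energy P h.
  rewrite /energy mulr_sumr -sumrB -big_split /=; apply: eq_bigr => w _; ring.
by rewrite e1 /energy; ring.
Qed.

(** As [D] is a union of cells of [Q], the sum over [D] sees [h] only through its [Q]-average. A
    large discrepancy thus forces the two averages apart in square mean, which [energy_refine] turns
    into an energy gain. *)
Lemma energy_increment (R : realFieldType) (W : finType) (J K : eqType)
    (P : W -> J) (Q : W -> K) (h : W -> R) (D : pred W) (eps : R) :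
  measurable_wrt Q P -> measurable_wrt Q D -> 0 < eps ->
  eps * #|W|%:R < \sum_(w | D w) (cell_avg P h w - h w) ->
  energy P h + eps ^+ 2 * #|W|%:R <= energy Q h.
Proof.
move=> QP QD eps0 hD; rewrite (energy_refine _ QP) lerD2l.
set d := fun w => cell_avg Q h w - cell_avg P h w.
have eD : \sum_(w | D w) (cell_avg P h w - h w) = \sum_(w | D w) - d w.
  pose k w : R := (D w)%:R.
  have mk : measurable_wrt Q k by move=> w w' /QD e; rewrite /k e.
  have E u : \sum_(w | D w) u w = \sum_w u w * k w.
    by rewrite big_mkcond; apply: eq_bigr => w _; rewrite /k; case: (D w);
       rewrite ?mulr1 ?mulr0.
  rewrite !E; under eq_bigr do rewrite mulrBl.
  rewrite sumrB -(cell_avg_adjoint h mk) -sumrB.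
  by apply: eq_bigr => w _; rewrite /d; ring.
rewrite eD in hD.
(* AM-GM: [2 eps (- d) <= d^2 + eps^2] *)
have : 2 * eps * (\sum_(w | D w) - d w) <= \sum_w (d w ^+ 2 + eps ^+ 2).
  rewrite mulr_sumr big_mkcond; apply: ler_sum => w _.
  have h1 : 0 <= (d w + eps) ^+ 2 by apply: sqr_ge0.
  have h2 : 0 <= d w ^+ 2 by apply: sqr_ge0.
  have h3 : 0 <= eps ^+ 2 by apply: sqr_ge0.
  case: ifP => _; last by lra.
  nra.
rewrite big_split /= sumr_const -(mulr_natr (eps ^+ 2)) => h1.
have h2 : 2 * eps * (eps * #|W|%:R) <= 2 * eps * (\sum_(w | D w) - d w).
  by rewrite ler_pM2l ?ltW //; lra.
have : 2 * eps * (eps * #|W|%:R) = 2 * (eps ^+ 2 * #|W|%:R) by ring.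
lra.
Qed.

(** * Weak regularity *)

Section WeakRegularity.

Variables (R : realFieldType) (V C : finType) (h : C -> V * V -> R) (N : nat).
Hypothesis h01 : forall a w, 0 <= h a w <= 1.
Implicit Types sigma : {ffun 'I_N -> {set V} * {set V}}.

(** The cell is named by its membership pattern, so the type of names depends on [N] but not on
    [V]. *)
Definition cell sigma (x : V) : {ffun 'I_N -> bool * bool} :=
  [ffun i => (x \in (sigma i).1, x \in (sigma i).2)].

Definition cell2 sigma (w : V * V) := (cell sigma w.1, cell sigma w.2).

(* One-sided closeness in cut norm suffices. *)
Definition regular sigma (eps : R) :=
  [forall a, forall S : {set V}, forall T : {set V},
    \sum_(w | (w.1 \in S) && (w.2 \in T))
       (cell_avg (cell2 sigma) (h a) w - h a w) <= eps * #|{: V * V}|%:R].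

(** Energy increment: a triple [a, S, T] that violates regularity supplies the next pair [(S, T)]
    and raises the total energy by [eps^2 |V|^2]. The total never exceeds [|C| |V|^2], so [N]
    increments are impossible. *)
Lemma weak_regularity (eps : R) : 0 < eps -> #|C|%:R < N%:R * eps ^+ 2 ->
  exists sigma, regular sigma eps.
Proof.
move=> eps0 hN; apply/existsP; apply: contraT => /existsPn nreg.
pose E sigma := \sum_a energy (cell2 sigma) (h a).
(* After [k] increments the entries from [k] on still hold [(set0, set0)], which separates no
   vertices; overwriting entry [k] therefore only refines the partition. *)
have step k : (k <= N)%N -> exists sigma,
    (forall i : 'I_N, (k <= i)%N -> sigma i = (set0, set0)) /\
    k%:R * (eps ^+ 2 * #|{: V * V}|%:R) <= E sigma.
  elim: k => [_ | k IH kN].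
    exists [ffun=> (set0, set0)]; split=> [i _|]; first by rewrite ffunE.
    by rewrite mul0r sumr_ge0 // => a _; apply: sumr_ge0 => w _; apply: sqr_ge0.
  have [sigma [s0 sE]] := IH (ltnW kN).
  have := nreg sigma; rewrite negb_forall => /existsP[a].
  rewrite negb_forall => /existsP[S]; rewrite negb_forall => /existsP[T].
  rewrite -ltNge => hST.
  pose k' := Ordinal kN.
  pose sigma' := [ffun i => if i == k' then (S, T) else sigma i].
  have c1 x y i : cell sigma' x = cell sigma' y -> i != k' ->
      cell sigma x i = cell sigma y i.
    move=> /ffunP/(_ i) e /negPf ik.
    by move: e; rewrite !ffunE ik.
  have c2 x y : cell sigma' x = cell sigma' y ->
      (x \in S) = (y \in S) /\ (x \in T) = (y \in T).
    by move/ffunP/(_ k'); rewrite !ffunE eqxx /= => -[-> ->].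
  have c3 x y : cell sigma' x = cell sigma' y -> cell sigma x = cell sigma y.
    move=> e; apply/ffunP => i; have [->|] := eqVneq i k'; last exact: c1.
    by rewrite !ffunE s0 // !inE.
  have r1 : measurable_wrt (cell2 sigma') (cell2 sigma).
    by case=> x y [x' y'] [/c3 e1 /c3 e2]; rewrite /cell2 /= e1 e2.
  have r2 : measurable_wrt (cell2 sigma')
      (fun w : V * V => (w.1 \in S) && (w.2 \in T)).
    by case=> x y [x' y'] [/c2[/= -> _] /c2[_ /= ->]].
  exists sigma'; split=> [i ki|].
    rewrite ffunE; case: eqP => [e|_]; last by rewrite s0 // ltnW.
    by move: ki; rewrite e /= ltnn.
  rewrite -natr1 mulrDl mul1r.
  apply: le_trans (_ : E sigma + eps ^+ 2 * #|{: V * V}|%:R <= _).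
    by rewrite lerD2r.
  have inc := energy_increment r1 r2 eps0 hST.
  rewrite /E (bigD1 a) //= [X in _ <= X](bigD1 a) //= addrAC.
  apply: lerD => //; apply: ler_sum => b _.
  rewrite (energy_refine _ r1) lerDl; apply: sumr_ge0 => w _; exact: sqr_ge0.
have [sigma [_ sE]] := step N (leqnn N).
have := nreg sigma; rewrite negb_forall => /existsP[a].
rewrite negb_forall => /existsP[S]; rewrite negb_forall => /existsP[T].
rewrite -ltNge => hST.
have W0 : 0 < #|{: V * V}|%:R :> R.
  rewrite ltr0n lt0n; apply: contraTneq hST => W0.
  rewrite W0 mulr0 big1 ?ltxx // => w _.
  by have := fintype0 w W0.
have : E sigma <= #|C|%:R * #|{: V * V}|%:R.
  apply: le_trans (_ : \sum_(b : C) #|{: V * V}|%:R <= _).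
    by apply: ler_sum => b _; exact: energy_le.
  by rewrite sumr_const -[X in X <= _]mulr_natl.
have : #|C|%:R * #|{: V * V}|%:R < N%:R * (eps ^+ 2 * #|{: V * V}|%:R) :> R.
  by rewrite mulrA ltr_pM2r.
lra.
Qed.

End WeakRegularity.

(** * Triangle counting from weak regularity *)

Section CountingLemma.

Variables (R : realFieldType) (V C : finType) (g : C -> V * V -> bool) (N : nat).
Variables (sigma : {ffun 'I_N -> {set V} * {set V}}) (eps : R).

Let h a w : R := (g a w)%:R.
Let f a := cell_avg (cell2 sigma) (h a).

Hypothesis reg : regular h sigma eps.

Lemma indicator_01 a w : 0 <= h a w <= 1.
Proof. by rewrite /h; case: (g a w); rewrite /= ?lexx ?ler01. Qed.

Lemma density_01 a w : 0 <= f a w <= 1.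
Proof.
rewrite cell_avg_ge0 ?cell_avg_le1 // => v; by case/andP: (indicator_01 a v).
Qed.

Let n2 : R := #|{: V * V}|%:R.

Lemma regular_rect a (S T : pred V) :
  \sum_x \sum_y (S x)%:R * (T y)%:R * (f a (x, y) - h a (x, y)) <= eps * n2.
Proof.
have /forallP/(_ a)/forallP/(_ [set x | S x])/forallP/(_ [set y | T y]) := reg.
apply: le_trans; rewrite pair_big /= [X in _ <= X]big_mkcond /=.
apply: ler_sum => -[x y] _ /=; rewrite !inE /f.
by case: (S x); case: (T y); rewrite /= ?mul1r ?mul0r.
Qed.

(** The sum is linear in each [u x], so it only grows when [u] becomes the indicator of the rows
    with positive contribution; this gives a rectangle. *)
Lemma regular_weighted a (u : V -> R) (T : pred V) : (forall x, 0 <= u x <= 1) ->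
  \sum_x \sum_y u x * (T y)%:R * (f a (x, y) - h a (x, y)) <= eps * n2.
Proof.
move=> u01.
pose q x := \sum_y (T y)%:R * (f a (x, y) - h a (x, y)).
apply: le_trans (regular_rect a (fun x => 0 < q x) T).
apply: ler_sum => x _.
under eq_bigr do rewrite -mulrA.
under [X in _ <= X]eq_bigr do rewrite -mulrA.
rewrite -!mulr_sumr -/(q x); case/andP: (u01 x) => u0 u1.
case: (ltP 0 (q x)) => q0; first by rewrite ler_wpM2r // ltW.
by rewrite mul0r mulr_ge0_le0.
Qed.

Lemma exchange3_zxy (F : V -> V -> V -> R) :
  \sum_x \sum_y \sum_z F x y z = \sum_z \sum_x \sum_y F x y z.
Proof.
under eq_bigr do rewrite exchange_big.
exact: exchange_big.
Qed.

(* Replace [g] by the density [f] one factor at a time: the first two steps use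
   regularity, and the third is exact because the other two factors are constant on
   cells. *)
Lemma triangle_density a b c :
  (forall x y z, ~~ [&& g a (x, y), g b (y, z) & g c (x, z)]) ->
  \sum_x \sum_y \sum_z f a (x, y) * f b (y, z) * f c (x, z)
    <= 2 * eps * (#|V|%:R * n2).
Proof.
move=> tri.
have bnd (q : V -> R) : (forall z, q z <= eps * n2) ->
    \sum_z q z <= eps * (#|V|%:R * n2).
  move=> hq; apply: le_trans (_ : \sum_(z : V) eps * n2 <= _).
    by apply: ler_sum => z _.
  by rewrite sumr_const -[X in X <= _]mulr_natl mulrCA.
have s1 : \sum_x \sum_y \sum_z f a (x, y) * h b (y, z) * h c (x, z)
    <= eps * (#|V|%:R * n2).
  rewrite exchange3_zxy; apply: bnd => z.
  apply: le_trans (regular_rect a (fun x => g c (x, z)) (fun y => g b (y, z))).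
  apply: ler_sum => x _; apply: ler_sum => y _.
  (* By [tri] the product with [h a] in place of [f a] vanishes, so for each [z] the sum is the
     discrepancy on a single rectangle. *)
  have := tri x y z; rewrite /h.
  by case: (g a _); case: (g b _); case: (g c _);
    rewrite //= ?mul1r ?mul0r ?mulr0 ?mulr1 ?subr0.
have s2 : \sum_x \sum_y \sum_z f a (x, y) * f b (y, z) * h c (x, z)
    <= \sum_x \sum_y \sum_z f a (x, y) * h b (y, z) * h c (x, z)
       + eps * (#|V|%:R * n2).
  rewrite -lerBlDl -sumrB; apply: bnd => x.
  rewrite -sumrB.
  have u01 y : 0 <= f a (x, y) <= 1 by apply: density_01.
  apply: le_trans (regular_weighted b (fun z => g c (x, z)) u01).
  apply: ler_sum => y _; rewrite -sumrB; apply: ler_sum => z _.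
  by rewrite /h le_eqVlt; apply/orP; left; apply/eqP; ring.
have s3 : \sum_x \sum_y \sum_z f a (x, y) * f b (y, z) * f c (x, z)
    = \sum_x \sum_y \sum_z f a (x, y) * f b (y, z) * h c (x, z).
  rewrite exchange_big [RHS]exchange_big; apply: eq_bigr => y _.
  pose k (w : V * V) := f a (w.1, y) * f b (y, w.2).
  have mk : measurable_wrt (cell2 sigma) k.
    case=> x z [x' z'] [e1 e2]; rewrite /k /=.
    rewrite /f (cell_avg_measurable _ (w := (x, y)) (w' := (x', y))) /cell2 /=.
      by rewrite (cell_avg_measurable _ (w := (y, z)) (w' := (y, z'))) //= e2.
    by rewrite e1.
  have := cell_avg_adjoint (h c) mk; rewrite !pair_big /= => e.
  transitivity (\sum_w f c w * k w).
    by apply: eq_bigr => -[x z] _; rewrite /k mulrC.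
  by rewrite /f e; apply: eq_bigr => -[x z] _; rewrite /k mulrC.
rewrite s3; lra.
Qed.

End CountingLemma.

(** * Templates *)

Lemma card_le_union (T I : finType) (A : {set T}) (B : I -> {set T}) :
  (forall t, t \in A -> exists i, t \in B i) -> (#|A| <= \sum_i #|B i|)%N.
Proof.
move=> AB; under eq_bigr do rewrite -sum1_card big_mkcond.
rewrite exchange_big -sum1_card big_mkcond /=; apply: leq_sum => t _.
case: ifP => // /AB[i tB]; rewrite (bigD1 i) //= tB; exact: leq_addr.
Qed.

Lemma card_natr (R : pzSemiRingType) (T : finType) (A : {set T}) :
  #|A|%:R = \sum_t (t \in A)%:R :> R.
Proof.
rewrite -sum1_card natr_sum big_mkcond; apply: eq_bigr => t _.
by case: (t \in A).
Qed.

(** The ordinal [i] stands for the colour [i + 1], so the triangle inequality for colours reads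
    [c <= (a + b).+1]. An empty set makes the triple metric. *)
Definition metric_triple (r : nat) (A B C : {set 'I_r}) : bool :=
  [forall a in A, forall b in B, forall c in C,
    [&& c <= (a + b).+1, a <= (b + c).+1 & b <= (a + c).+1]%N].

Definition nonmetric_triples (r : nat) (V : finType) (T : V -> V -> {set 'I_r}) :
    {set V * V * V} :=
  [set t | ~~ metric_triple (T t.1.1 t.1.2) (T t.1.2 t.2) (T t.1.1 t.2)].

(* A code is a pair of an [N]-tuple of pairs of vertex sets, which determines the
   partition into cells, and a choice of a colour set for each pair of cells. *)
Definition template_code (r N : nat) (V : finType) : finType :=
  ({ffun 'I_N -> {set V} * {set V}} *
   {ffun {ffun 'I_N -> bool * bool} * {ffun 'I_N -> bool * bool} -> {set 'I_r}})%type.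

(** Intersecting the two orders makes every template symmetric. *)
Definition template (r N : nat) (V : finType) (k : template_code r N V) (x y : V) :
    {set 'I_r} :=
  k.2 (cell k.1 x, cell k.1 y) :&: k.2 (cell k.1 y, cell k.1 x).

Lemma template_sym (r N : nat) (V : finType) (k : template_code r N V) x y :
  template k x y = template k y x.
Proof. by rewrite /template setIC. Qed.

Lemma template_exists (R : realFieldType) (r N : nat) (V : finType)
    (c : V -> V -> {set 'I_r}) (eps eta : R) :
  0 < eps -> r%:R < N%:R * eps ^+ 2 -> 0 < eta ->
  (forall x y, c x y = c y x) ->
  (forall x y z, metric_triple (c x y) (c y z) (c x z)) ->
  exists k : template_code r N V,
    #|nonmetric_triples (template k)|%:R * eta ^+ 3
      <= r%:R ^+ 3 * (2 * eps) * #|V|%:R ^+ 3 /\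
    #|[set w : V * V | ~~ (c w.1 w.2 \subset template k w.1 w.2)]|%:R
      <= 2 * r%:R * eta * #|V|%:R ^+ 2.
Proof.
move=> eps0 hN eta0 csym cmet.
pose g (a : 'I_r) (w : V * V) : bool := a \in c w.1 w.2.
pose h a w : R := (g a w)%:R.
have h01 : forall a w, 0 <= h a w <= 1 by exact: indicator_01.
have hN' : #|{: 'I_r}|%:R < N%:R * eps ^+ 2 by rewrite card_ord.
have [sigma reg] := weak_regularity h01 eps0 hN'.
pose f a := cell_avg (cell2 sigma) (h a).
have f01 a w : 0 <= f a w <= 1 by apply: density_01.
pose tau := [ffun ij => [set a |
  [exists w, (cell2 sigma w == ij) && (eta <= f a w)]]].
have tauE a x y : (a \in tau (cell sigma x, cell sigma y)) = (eta <= f a (x, y)).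
  rewrite ffunE inE; apply/existsP/idP => [[w /andP[/eqP e]] | hf].
    by rewrite /f (cell_avg_measurable _ (w := w) (w' := (x, y))).
  by exists (x, y); rewrite eqxx hf.
have Vsq : #|{: V * V}|%:R = #|V|%:R ^+ 2 :> R by rewrite card_prod natrM expr2.
exists (sigma, tau); split.
- set T := template _.
  pose B (abc : 'I_r * 'I_r * 'I_r) : {set V * V * V} :=
    [set t | [&& t \in nonmetric_triples T,
       ~~ [&& abc.2 <= (abc.1.1 + abc.1.2).+1, abc.1.1 <= (abc.1.2 + abc.2).+1
          & abc.1.2 <= (abc.1.1 + abc.2).+1]%N,
      abc.1.1 \in T t.1.1 t.1.2, abc.1.2 \in T t.1.2 t.2 & abc.2 \in T t.1.1 t.2]].
  have : (#|nonmetric_triples T| <= \sum_abc #|B abc|)%N.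
    apply: card_le_union => t tN; move: (tN); rewrite inE.
    rewrite negb_forall_in => /exists_inP[a aT].
    rewrite negb_forall_in => /exists_inP[b bT].
    rewrite negb_forall_in => /exists_inP[d dT] nok.
    by exists (a, b, d); rewrite inE tN /= nok aT bT dT.
  rewrite -(ler_nat R) natr_sum => /(ler_wpM2r (exprn_ge0 3 (ltW eta0))).
  move/le_trans; apply; rewrite mulr_suml.
  apply: le_trans (_ : \sum_(abc : 'I_r * 'I_r * 'I_r) 2 * eps * #|V|%:R ^+ 3 <= _);
    last first.
    rewrite sumr_const !card_prod card_ord -[X in X <= _]mulr_natl !natrM.
    by rewrite le_eqVlt; apply/orP; left; apply/eqP; ring.
  apply: ler_sum => -[[a b] d] _.
  have [ok | nok] := boolP [&& d <= (a + b).+1, a <= (b + d).+1 & b <= (a + d).+1]%N.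
    have -> : #|B (a, b, d)| = 0%N.
      by apply/eqP; rewrite cards_eq0; apply/eqP/setP => t; rewrite !inE /= ok andbF.
    by rewrite mul0r !mulr_ge0 ?exprn_ge0 ?ler0n ?ltW.
  have tri x y z : ~~ [&& g a (x, y), g b (y, z) & g d (x, z)].
    apply: contra nok => /and3P[ga gb gd].
    have /forall_inP/(_ a ga)/forall_inP/(_ b gb)/forall_inP/(_ d gd) := cmet x y z.
    by [].
  have := triangle_density reg tri.
  rewrite Vsq -exprS; apply: le_trans; rewrite card_natr mulr_suml.
  rewrite pair_big /= pair_big /=; apply: ler_sum => -[[x y] z] _ /=.
  have f0 e w : 0 <= f e w by case/andP: (f01 e w).
  have [xyz | _] := boolP (_ \in B _); last first.
    by rewrite mul0r; apply: mulr_ge0; first apply: mulr_ge0; apply: f0.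

  move: xyz; rewrite inE /= => /and5P[_ _].
  rewrite /T /template !inE /= !tauE => /andP[ha _] /andP[hb _] /andP[hd _].
  rewrite mul1r 2!exprS expr1 mulrA; have e0 := ltW eta0.
  apply: ler_pM => //; first exact: mulr_ge0.
  exact: ler_pM.
set T := template _.
pose B (ab : 'I_r * bool) : {set V * V} :=
  [set w | g ab.1 w && (f ab.1 (if ab.2 then w else (w.2, w.1)) < eta)].
have : (#|[set w | ~~ (c w.1 w.2 \subset T w.1 w.2)]| <= \sum_ab #|B ab|)%N.
  apply: card_le_union => -[x y]; rewrite inE /= => /subsetPn[a ac].
  rewrite /T /template !inE /= !tauE negb_and -!ltNge => /orP[] hf.
    by exists (a, true); rewrite inE /g /= ac.
  by exists (a, false); rewrite inE /g /= ac.
rewrite -(ler_nat R) natr_sum => /le_trans; apply.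
apply: le_trans (_ : \sum_(ab : 'I_r * bool) eta * #|V|%:R ^+ 2 <= _); last first.
  rewrite sumr_const card_prod card_ord card_bool -[X in X <= _]mulr_natl !natrM.
  by rewrite le_eqVlt; apply/orP; left; apply/eqP; ring.
apply: ler_sum => -[a b] _.
(* As [c] is symmetric, swapping coordinates reduces the reversed order to the direct one. *)
have -> : #|B (a, b)| = #|[set w | g a w && (f a w < eta)]|.
  case: b; first by congr #|pred_of_set _|; apply/setP => w; rewrite !inE.
  pose sw (w : V * V) := (w.2, w.1).
  have swK : involutive sw by case.
  rewrite -(card_imset _ (inv_inj swK)); congr #|pred_of_set _|.
  apply/setP => -[x y]; rewrite -[(x, y)]swK mem_imset ?inE /=; last exact: inv_inj.
  by rewrite /g /= csym.
rewrite -Vsq; apply: le_trans (low_density_mass (cell2 sigma) (h a) (ltW eta0)).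
rewrite card_natr [X in _ <= X]big_mkcond; apply: ler_sum => w _.
rewrite inE /h /f andbC; case: ifP => //.
Qed.

(** * Sizes of colour sets in metric triples *)

Section MatchingBound.

Variables (R : realFieldType) (V : finType) (phi : V -> V -> R) (bad : rel V) (K q : R).
Hypotheses (phiC : forall x y, phi x y = phi y x) (phiK : forall x y, phi x y <= K).
Hypotheses (K0 : 0 <= K) (q0 : 0 <= q).
Hypothesis heavy : forall x y, ~~ bad x y -> 0 < phi x y ->
  #|[set z | 0 < phi x z + phi y z]|%:R <= q.

Lemma sum_square_remove (U : {set V}) x : x \in U ->
  \sum_(y in U) \sum_(z in U) phi y z
  = phi x x + 2 * (\sum_(z in U :\ x) phi x z)
    + \sum_(y in U :\ x) \sum_(z in U :\ x) phi y z.
Proof.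
move=> xU; rewrite (big_setD1 x) //= (big_setD1 x) //=.
under [X in _ + X = _]eq_bigr do rewrite (big_setD1 x) //= phiC.
rewrite big_split /=; ring.
Qed.

(* Remove the two ends of a positive good pair: together they contribute at most
   [4 K q + 4 K].  Once no such pair is left, only bad and diagonal pairs count. *)
Lemma matching_bound (U : {set V}) :
  \sum_(x in U) \sum_(y in U) phi x y
  <= K * #|[set w | bad w.1 w.2]|%:R + #|U|%:R * (2 * K * q + 2 * K).
Proof.
have [n] := ubnP #|U|; elim: n U => // n IH U Un.
have Kq : 0 <= K * q by exact: mulr_ge0.
have [[x [y [xU yU xy nbad pos]]]|none] : (exists x y, [/\ x \in U, y \in U, x != y,
   ~~ bad x y & 0 < phi x y]) \/ (forall x y, x \in U -> y \in U -> x != y ->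
   ~~ bad x y -> phi x y <= 0).
  case: (boolP [exists x, exists y, [&& x \in U, y \in U, x != y,
     ~~ bad x y & 0 < phi x y]]) => [/existsP[x /existsP[y /and5P[]]]|].
    by left; exists x, y; split.
  move=> no; right=> x y xU yU xy nbad; rewrite leNgt; apply: contra no => pos.
  by apply/existsP; exists x; apply/existsP; exists y; apply/and5P; split.
- have yU' : y \in U :\ x by rewrite !inE eq_sym xy.
  have cU := cardsD1 x U; have cU' := cardsD1 y (U :\ x).
  rewrite xU in cU; rewrite yU' in cU'.
  rewrite (sum_square_remove xU) (sum_square_remove yU') (big_setD1 y) //=.
  set U' := U :\ x :\ y in cU' *.
  have lt : (#|U'| < n)%N by move: Un; rewrite cU cU' /= !add1n; lia.
  have := IH U' lt; set b := K * _.
  have : \sum_(z in U') (phi x z + phi y z) <= 2 * K * q.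
    apply: le_trans (_ : \sum_(z in [set z | 0 < phi x z + phi y z]) 2 * K <= _).
      rewrite big_mkcond [X in _ <= X]big_mkcond; apply: ler_sum => z _.
      have := phiK x z; have := phiK y z.
      by rewrite inE; case: ifP => _; case: ltP => *; lra.
    rewrite sumr_const -[X in X <= _]mulr_natr; apply: ler_wpM2l.
      by rewrite mulr_ge0.
    exact: (heavy nbad pos).
  have -> : #|U|%:R = #|U'|%:R + 2 :> R by rewrite cU cU' addnA natrD addrC.
  rewrite big_split /= (mulrDl #|U'|%:R 2).
  move: (\sum_(z in U') phi x z) (\sum_(z in U') phi y z) (\sum_(y in U') \sum_(z in U') _) => s1 s2 s3.
  have := phiK x x; have := phiK y y; have := phiK x y.
  move: (#|U'|%:R * _) => p; move: K0; clear; lra.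
have -> : K * #|[set w | bad w.1 w.2]|%:R
    = \sum_x \sum_y K * (bad x y)%:R.
  rewrite card_natr mulr_sumr pair_big /=; apply: eq_bigr => -[x y] _.
  by rewrite inE.
apply: le_trans (_ : \sum_(x in U) \sum_(y in U) (K * (bad x y)%:R + K * (x == y)%:R) <= _).
  apply: ler_sum => x xU; apply: ler_sum => y yU.
  have [_|xy] := eqVneq x y.
    rewrite mulr1; have := phiK x y; have : 0 <= K * (bad x y)%:R by exact: mulr_ge0.
    lra.
  rewrite mulr0 addr0; case: (boolP (bad x y)) => [_|nb]; first by rewrite mulr1.
  by rewrite mulr0 none.
under eq_bigr do rewrite big_split /=.
rewrite big_split /=; apply: lerD.
  have b0 x y : 0 <= K * (bad x y)%:R by exact: mulr_ge0.
  rewrite big_mkcond; apply: ler_sum => x _; case: ifP => _; last exact: sumr_ge0.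
  by rewrite big_mkcond; apply: ler_sum => y _; case: ifP.
apply: le_trans (_ : \sum_(x in U) K <= _).
  apply: ler_sum => x xU; rewrite (bigD1 x) //= eqxx mulr1 big1 ?addr0 // => y.
  by rewrite eq_sym => /andP[_ /negPf ->]; rewrite mulr0.
rewrite sumr_const -[X in X <= _]mulr_natl; apply: ler_wpM2l => //; by have k0 := K0; lra.
Qed.

End MatchingBound.

(** If a factor falls short of [m] by [d > 0], then [a (a + 2 d) = (a + d)^2 - d^2] loses at least
    1. *)
Lemma mul_le_sq (y z m : nat) : (y + z <= m + m)%N ->
  (y * z <= m ^ 2 - ~~ ((y == m) && (z == m)))%N.
Proof.
have lt a b d : (0 < d)%N -> (b <= a + (d + d) -> a * b <= (a + d) ^ 2 - 1)%N.
  by move=> d0 bd; have : (a * b <= a * (a + (d + d)))%N; [rewrite leq_mul2l bd orbT | nia].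
move=> s; have [ym|ym] := ltnP y m.
  have -> : ~~ ((y == m) && (z == m)) by lia.
  have e : (y + (m - y) = m)%N by lia.
  by have := lt y z (m - y)%N; rewrite e => h; apply: h; lia.
have [zm|zm] := ltnP z m.
  have -> : ~~ ((y == m) && (z == m)) by lia.
  have e : (z + (m - z) = m)%N by lia.
  by have := lt z y (m - z)%N; rewrite e mulnC => h; apply: h; lia.
have -> : y = m by lia.
have -> : z = m by lia.
by rewrite eqxx /= subn0 -mulnn.
Qed.

Section ColorIntervals.

Variable r : nat.
Implicit Types A B C : {set 'I_r}.

Lemma card_color_itv a b : (#|color_itv r a b| <= b.+1 - a)%N.
Proof.
rewrite cardE -(size_map (fun i : 'I_r => i.+1)) -[X in (_ <= X)%N](size_iota a).
apply: uniq_leq_size.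
  by rewrite map_inj_uniq ?enum_uniq // => i j [/val_inj].
move=> _ /mapP[i + ->]; rewrite mem_enum inE mem_iota; lia.
Qed.

Lemma card_sub_itv A a b : A \subset color_itv r a b -> (#|A| <= b.+1 - a)%N.
Proof. by move=> /subset_leq_card /leq_trans; apply; exact: card_color_itv. Qed.

Lemma eq_color_itv A a b : A \subset color_itv r a b -> (b.+1 - a <= #|A|)%N ->
  A = color_itv r a b.
Proof.
move=> sA cA; apply/eqP; rewrite eqEcard sA.
exact: leq_trans (card_color_itv a b) cA.
Qed.

Lemma ex_min_color A : (0 < #|A|)%N -> exists2 a, a \in A & forall i, i \in A -> (a <= i)%N.
Proof.
move=> /card_gt0P[a0 a0A].
case: (arg_minnP (fun i : 'I_r => i : nat) a0A) => a aA amin.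
by exists a.
Qed.

Lemma metric_tripleC A B C : metric_triple A B C -> metric_triple B A C.
Proof.
move=> /forall_inP h; apply/forall_inP => b bB; apply/forall_inP => a aA.
apply/forall_inP => c cC.
have /forall_inP/(_ b bB)/forall_inP/(_ c cC) := h a aA; lia.
Qed.

Lemma metric_tripleCA A B C : metric_triple A B C -> metric_triple B C A.
Proof.
move=> /forall_inP h; apply/forall_inP => b bB; apply/forall_inP => c cC.
apply/forall_inP => a aA.
have /forall_inP/(_ b bB)/forall_inP/(_ c cC) := h a aA; lia.
Qed.

Lemma metric_triple_itv A B C (a b c : 'I_r) : metric_triple A B C ->
  (forall i, i \in A -> a <= i)%N -> b \in B -> c \in C ->
  A \subset color_itv r a.+1 (b.+1 + c.+1).
Proof.
move=> /forall_inP h amin bB cC; apply/subsetP => i iA; rewrite inE.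
have := amin i iA.
by have /forall_inP/(_ b bB)/forall_inP/(_ c cC) := h i iA; lia.
Qed.

Let m := r./2.+1.

(** Let [a, b, c] be the least colours. Then [B] lies in [[b, a + c]] and [C] in [[c, a + b]], so
    [|B| + |C| <= 2 a + 2]; and [|A| > m] forces [a <= r - m], whence the sum is at most [2 m]. If
    [B] or [C] is empty, the product is at most [r <= m^2 - 1]. *)
Lemma size_product_big A B C : (1 < r)%N -> metric_triple A B C -> (m < #|A|)%N ->
  (maxn 1 #|B| * maxn 1 #|C| <= m ^ 2 - ~~ ((#|B| == m) && (#|C| == m)))%N.
Proof.
move=> r1 met mA.
have mr : (r <= m + m - 1)%N by have := odd_double_half r; rewrite /m; lia.
have m2 : (1 < m)%N by have := odd_double_half r; rewrite /m; lia.
have cr D : (#|D : {set 'I_r}| <= r)%N by rewrite -[X in (_ <= X)%N]card_ord max_card.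
have [B0|B0] := posnP #|B|.
  have := cr C; rewrite B0; case: eqP => [|_ ]; [lia | nia].
have [C0|C0] := posnP #|C|.
  have := cr B; rewrite C0 andbC; case: eqP => [|_ ]; [lia | nia].
have [a aA amin] : exists2 a, a \in A & forall i, i \in A -> (a <= i)%N.
  by apply: ex_min_color; lia.
have [b bB bmin] := ex_min_color B0.
have [c cC cmin] := ex_min_color C0.
have sA : A \subset color_itv r a.+1 r.
  by apply/subsetP => i /amin; rewrite inE; have := ltn_ord i; lia.
have := card_sub_itv sA.
have := card_sub_itv (metric_triple_itv (metric_tripleC met) bmin aA cC).
have met' : metric_triple C A B by do 2! apply: metric_tripleCA.
have := card_sub_itv (metric_triple_itv met' cmin aA bB).
move=> h1 h2 h3; have s : (#|B| + #|C| <= m + m)%N by lia.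
have -> : maxn 1 #|B| = #|B| by lia.
have -> : maxn 1 #|C| = #|C| by lia.
exact: mul_le_sq.
Qed.

End ColorIntervals.

(** * Logarithmic sizes in an almost metric template *)

Section TypicalSizes.

Variables (R : realType) (r : nat) (V : finType) (T : V -> V -> {set 'I_r}).
Hypotheses (hr : (3 <= r)%N) (TC : forall x y, T x y = T y x).

Let m := r./2.+1.
Let n : R := #|V|%:R.

(* [- 2 * size_gap] is the logarithm of (m^2 - 1) / m^2, the largest loss factor of
   a pair of sizes that is allowed next to a big set and is not (m, m). *)
Definition size_gap : R := (ln (m ^ 2)%:R - ln (m ^ 2 - 1)%:R) / 2.

(** With [maxn 1] an empty set has logarithmic size 0, and the exponential is still an upper bound
    for the size. *)
Definition log_size (A : {set 'I_r}) : R := ln (maxn 1 #|A|)%:R.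

Let c := size_gap.
Let K : R := ln r%:R + c.

Lemma half_succ_gt1 : (1 < m)%N.
Proof. by have := odd_double_half r; rewrite /m; lia. Qed.

Lemma size_gap_gt0 : 0 < size_gap.
Proof.
have m1 := half_succ_gt1; have m4 : (4 <= m ^ 2)%N by nia.
rewrite /size_gap divr_gt0 // subr_gt0 ltr_ln ?posrE ?ltr0n ?ltr_nat; lia.
Qed.

Lemma ln_m2 : ln (m ^ 2)%:R = 2 * ln m%:R :> R.
Proof. by rewrite natrX lnXn ?ltr0n // mulr_natl. Qed.

Lemma ln_m2B1 : ln (m ^ 2 - 1)%:R = 2 * ln m%:R - 2 * c :> R.
Proof. by rewrite /c /size_gap ln_m2; field. Qed.

Lemma log_size_le A : log_size A <= ln r%:R.
Proof.
have cA : (#|A| <= r)%N by rewrite -[X in (_ <= X)%N]card_ord max_card.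
rewrite /log_size ler_ln ?posrE ?ltr0n ?ler_nat; lia.
Qed.

(** The excess over the typical logarithmic size, plus a penalty [c] for any size other than [m]; an
    upper bound for its sum controls the product of sizes and the number of atypical pairs at
    once. *)
Let phi x y : R := log_size (T x y) - ln m%:R + c * (#|T x y| != m)%:R.

Lemma excess_le x y : phi x y <= K.
Proof.
have c0 := size_gap_gt0; have m0 : 0 <= ln m%:R :> R by rewrite ln_ge0 // ler1n.
have := log_size_le (T x y); rewrite /phi /K -/c in c0 *.
case: (_ != _); rewrite ?mulr1 ?mulr0; lra.
Qed.

Lemma excess_gt0_size x y : 0 < phi x y -> (m < #|T x y|)%N.
Proof.
have c0 := size_gap_gt0; rewrite -/c in c0.
rewrite ltnNge; apply: contraTN => le; rewrite -leNgt /phi /log_size.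
have m1 := half_succ_gt1.
have [e|ne] := eqVneq #|T x y| m.
  by rewrite e mulr0 (maxn_idPr _) ?subrr ?addr0 //; lia.
set s := maxn 1 _; have sm : (s <= m - 1)%N by rewrite /s; lia.
have : ln (s ^ 2)%:R <= ln (m ^ 2 - 1)%:R :> R.
  have m4 : (4 <= m ^ 2)%N by nia.
  by rewrite ler_ln ?posrE ?ltr0n ?ler_nat /s; nia.
have e : ln (s ^ 2)%:R = 2 * ln s%:R :> R.
  by rewrite natrX lnXn ?mulr_natl // ltr0n /s; lia.
by rewrite e ln_m2B1 /= mulr1; lra.
Qed.

(** Unless both sizes are [m], the product is at most [m^2 - 1]; this loses [2 c], enough to pay for
    both penalties. *)
Lemma excess_add_le0 x y z : (m < #|T x y|)%N ->
  metric_triple (T x y) (T y z) (T x z) -> phi x z + phi y z <= 0.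
Proof.
move=> big met; have c0 := size_gap_gt0; rewrite -/c in c0.
have r1 : (1 < r)%N by lia.
have := size_product_big r1 met big; rewrite -/m /phi /log_size.
set s1 := maxn 1 #|T y z|; set s2 := maxn 1 #|T x z| => le.
have m1 := half_succ_gt1; have m4 : (4 <= m ^ 2)%N by nia.
have : ln s1%:R + ln s2%:R = ln (s1 * s2)%:R :> R.
  by rewrite natrM lnM // posrE ltr0n /s1 /s2; lia.
have : ln (s1 * s2)%:R
    <= ln (m ^ 2 - ~~ ((#|T y z| == m) && (#|T x z| == m)))%:R :> R.
  rewrite ler_ln ?posrE ?ltr0n ?ler_nat //; first by rewrite muln_gt0 /s1 /s2; lia.
  by case: (_ && _) => /=; lia.
have e1 := ln_m2B1; have e2 := ln_m2; rewrite -/c in e1.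
by case: (_ == m); case: (_ == m) => /=; rewrite ?subn0 ?e1 ?e2; lra.
Qed.

(** Apply [matching_bound] to [phi], with a pair bad when it lies in more than [zeta n] nonmetric
    triples. For a good pair of positive excess, only the nonmetric [z] can have [phi x z + phi y z]
    positive. *)
Lemma typical_sizes (zeta xi : R) : 0 < zeta ->
  #|nonmetric_triples T|%:R <= xi * n ^+ 3 ->
  \sum_x \sum_y log_size (T x y)
    + c * #|[set w | #|T w.1 w.2| != m]|%:R
  <= n ^+ 2 * ln m%:R + K * (xi / zeta + 2 * zeta) * n ^+ 2 + 2 * K * n.
Proof.
move=> zeta0 hxi.
have n0 : 0 <= n by exact: ler0n.
have K0 : 0 <= K.
  by rewrite /K addr_ge0 ?ln_ge0 ?ler1n ?(ltW size_gap_gt0) //; lia.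
pose bad x y := zeta * n < #|[set z | ~~ metric_triple (T x y) (T y z) (T x z)]|%:R.
have phiC x y : phi x y = phi y x by rewrite /phi TC.
have heavy x y : ~~ bad x y -> 0 < phi x y ->
    #|[set z | 0 < phi x z + phi y z]|%:R <= zeta * n.
  rewrite -leNgt => le /excess_gt0_size big; apply: le_trans le; rewrite ler_nat.
  apply/subset_leq_card/subsetP => z; rewrite !inE; apply: contraTN => met.
  by rewrite -leNgt excess_add_le0.
have := matching_bound phiC excess_le K0 (mulr_ge0 (ltW zeta0) n0) heavy setT.
have -> : \sum_(x in setT) \sum_(y in setT) phi x y =
  \sum_x \sum_y log_size (T x y) - n ^+ 2 * ln m%:R + c * #|[set w | #|T w.1 w.2| != m]|%:R.
  under eq_bigl do rewrite inE.
  under eq_bigr do under eq_bigl do rewrite inE.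
  rewrite card_natr !pair_big /= mulr_sumr /phi.
  have -> : n ^+ 2 * ln m%:R = \sum_(w : V * V) ln m%:R.
    by rewrite sumr_const card_prod -[RHS]mulr_natl natrM expr2.
  by rewrite -sumrB -big_split; apply: eq_bigr => w _; rewrite inE.
rewrite cardsT -/n.
(* Markov's inequality: each bad pair accounts for at least [zeta n] nonmetric triples. *)
have : #|[set w | bad w.1 w.2]|%:R * (zeta * n) <= xi * n ^+ 3.
  apply: le_trans hxi; rewrite !card_natr mulr_suml.
  have -> : \sum_t (t \in nonmetric_triples T)%:R =
      \sum_(w : V * V) \sum_z ((w, z) \in nonmetric_triples T)%:R :> R.
    by rewrite pair_big; apply: eq_bigr => -[w z] _.
  apply: ler_sum => w _; rewrite inE.
  case: (boolP (bad _ _)) => [|_]; last by rewrite mul0r sumr_ge0.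
  rewrite mul1r /bad card_natr => /ltW /le_trans; apply.
  by apply: ler_sum => z _; rewrite !inE.
set b := #|_|%:R => hb.
have hb' : b <= xi / zeta * n ^+ 2.
  have [n_eq0|n_neq0] := eqVneq n 0.
    rewrite n_eq0 expr0n mulr0 /b.
    have -> : [set w | bad w.1 w.2] = set0; last by rewrite cards0.
    apply/setP => -[x y]; exfalso.
    have : (0 < #|V|)%N by apply/card_gt0P; exists x.
    by move/eqP: n_eq0; rewrite pnatr_eq0 => /eqP ->.
  have n1 : 0 < n by rewrite lt_neqAle eq_sym n_neq0.
  rewrite -(ler_pM2r (mulr_gt0 zeta0 n1)); apply: le_trans hb _.
  by rewrite le_eqVlt; apply/orP; left; apply/eqP; field; rewrite gt_eqF.
have := ler_wpM2l K0 hb'.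
lra.
Qed.

End TypicalSizes.

(** * Almost transitive relations *)

Lemma card_pairs (R : pzSemiRingType) (V : finType) (b : rel V) :
  #|[set w | b w.1 w.2]|%:R = \sum_x \sum_y (b x y)%:R :> R.
Proof. by rewrite card_natr pair_big; apply: eq_bigr => w _; rewrite inE. Qed.

Lemma card_triples (R : pzSemiRingType) (V : finType) (b : V -> V -> V -> bool) :
  #|[set t | b t.1.1 t.1.2 t.2]|%:R = \sum_x \sum_y \sum_z (b x y z)%:R :> R.
Proof. by rewrite card_natr !pair_big; apply: eq_bigr => w _; rewrite inE. Qed.

Section Clustering.

Variables (R : realFieldType) (V : finType) (E : rel V) (q : R).
Hypotheses (Erefl : reflexive E) (Esym : symmetric E) (q0 : 0 < q).

Let D : R := \sum_x \sum_y \sum_z (E x y && E y z && ~~ E x z)%:R.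

(* Pivoting: take [N x] as a class whenever this costs at most [q * #|N x|] bad
   triples through [x]; classes are disjoint, so this costs [q * #|U|] in total.  If no
   [x] qualifies, summing over [x] shows that there are few related pairs left. *)
Lemma clustering_in (U : {set V}) : exists f : V -> V,
  (forall x, x \in U -> f x \in U) /\
  \sum_(x in U) \sum_(y in U) (E x y != (f x == f y))%:R <= q * #|U|%:R + 3 * D / q.
Proof.
have [n] := ubnP #|U|; elim: n U => // n IH U Un.
pose N x := [set y in U | E x y].
pose D1 x : R := \sum_y \sum_z (E x y && E y z && ~~ E x z)%:R.
pose D2 x : R := \sum_y \sum_z (E y x && E x z && ~~ E y z)%:R.
have D1_0 x : 0 <= D1 x by apply: sumr_ge0 => y _; exact: sumr_ge0.
have D2_0 x : 0 <= D2 x by apply: sumr_ge0 => y _; exact: sumr_ge0.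
have [|] := boolP [exists x in U, D2 x + 2 * D1 x <= q * #|N x|%:R].
  move=> /exists_inP[x xU cost].
  have NU : N x \subset U by apply/subsetP => y; rewrite inE => /andP[].
  have cU : #|U| = (#|N x| + #|U :\: N x|)%N.
    by rewrite -(cardsID (N x) U) (setIidPr NU).
  have xN : x \in N x by rewrite inE xU Erefl.
  have Npos : (0 < #|N x|)%N by apply/card_gt0P; exists x.
  have [|f [fU hf]] := IH (U :\: N x); first by lia.
  exists (fun y => if y \in N x then x else f y); split=> [y yU|].
    case: ifP => // yN; have : f y \in U :\: N x by apply: fU; rewrite inE yN.
    by rewrite inE => /andP[].
  have -> : q * #|U|%:R + 3 * D / q
      = q * #|U :\: N x|%:R + 3 * D / q + q * #|N x|%:R.
    by rewrite cU natrD; ring.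
  apply: le_trans (lerD hf cost).
  (* The three summands pay for the three kinds of wrong pair that meet [N x]: unrelated inside it,
     or related across its boundary in either order. *)
  have -> : D2 x + 2 * D1 x = \sum_y \sum_z ((E y x && E x z && ~~ E y z)%:R
     + (E x y && E y z && ~~ E x z)%:R + (E x z && E z y && ~~ E x y)%:R).
    under [RHS]eq_bigr do rewrite !big_split.
    rewrite !big_split /= -/(D1 x) -/(D2 x) [X in _ = _ + X]exchange_big /=.
    by rewrite -/(D1 x); ring.
  rewrite big_mkcond [X in _ <= X + _]big_mkcond -big_split; apply: ler_sum => y _.
  rewrite /=; have i3 (a b c : R) : 0 <= a -> 0 <= b -> 0 <= c -> 0 <= a + b + c.
    by move=> *; rewrite !addr_ge0.
  have [yU|yU] := boolP (y \in U); last first.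
    by rewrite inE (negPf yU) andbF add0r; apply: sumr_ge0 => z _; exact: i3.
  have -> : (if y \in U :\: N x then \sum_(z in U :\: N x) (E y z != (f y == f z))%:R else 0)
     = \sum_z ((y \in U :\: N x) && (z \in U :\: N x) && (E y z != (f y == f z)))%:R :> R.
    case: ifP => _; last by rewrite big1.
    by rewrite big_mkcond; apply: eq_bigr => z _; case: ifP.
  rewrite big_mkcond -big_split; apply: ler_sum => z _ /=.
  case: ifP => zU; last by rewrite addr_ge0 // i3.
  rewrite !(inE, yU, zU) /=.
  (* The labels of the remaining vertices stay in the remainder, so the label [x] is not reused. *)
  have fx v : v \in U -> ~~ E x v -> (x == f v) = false.
    move=> vU xv; apply/eqP => e; have : f v \in U :\: N x by rewrite fU // !inE vU xv.
    by rewrite -e inE xN.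
  rewrite (Esym z y) (Esym y x).
  case: (boolP (E x y)) => xy; case: (boolP (E x z)) => xz /=.
  - by rewrite eqxx; case: (E y z); rewrite /= ?addr0 ?add0r.
  - by rewrite fx //; case: (E y z); rewrite /= ?addr0 ?add0r.
  - by rewrite (eq_sym (f y)) fx //; case: (E y z); rewrite /= ?addr0 ?add0r.
  - by rewrite !addr0.
rewrite negb_exists_in => /forall_inP nx.
(* All classes are singletons; the errors are related pairs of distinct vertices, at most the sum of
   the [#|N x|]. *)
exists id; split=> //.
have : q * (\sum_(x in U) #|N x|%:R) <= 3 * D.
  rewrite mulr_sumr; apply: le_trans (_ : \sum_(x in U) (D2 x + 2 * D1 x) <= _).
    by apply: ler_sum => x /nx; rewrite -ltNge => /ltW.
  apply: le_trans (_ : \sum_x (D2 x + 2 * D1 x) <= _).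
    rewrite big_mkcond; apply: ler_sum => x _; case: ifP => // _.
    by rewrite addr_ge0 // mulr_ge0.
  rewrite big_split -mulr_sumr /= -/D.
  have -> : \sum_x D2 x = D by rewrite /D2 exchange_big.
  by rewrite le_eqVlt; apply/orP; left; apply/eqP; ring.
rewrite mulrC -ler_pdivlMr // => h; apply: le_trans (_ : \sum_(x in U) #|N x|%:R <= _).
  apply: ler_sum => x xU; rewrite card_natr big_mkcond; apply: ler_sum => y _.
  rewrite inE; case: (y \in U) => //=.
  by have [->|_] := eqVneq x y; [rewrite Erefl | case: (E x y)].
by rewrite -[X in X <= _]add0r lerD // mulr_ge0 // ltW.
Qed.

End Clustering.

Lemma clustering (R : realFieldType) (V : finType) (E : rel V) (q omega : R) :
  reflexive E -> symmetric E -> 0 < q -> 0 <= omega ->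
  \sum_x \sum_y \sum_z (E x y && E y z && ~~ E x z)%:R <= omega * #|V|%:R ^+ 3 ->
  exists f : V -> V, #|[set w | E w.1 w.2 != (f w.1 == f w.2)]|%:R
    <= (q + 3 * omega / q) * #|V|%:R ^+ 2.
Proof.
move=> Er Es q0 om0 hD.
have [/eqP V0|V1] := posnP #|V|.
  exists id; rewrite (card_pairs R (fun x y => E x y != (id x == id y))) big1 => [|x].
    apply: mulr_ge0; last exact: sqr_ge0.
    apply: addr_ge0; first exact: ltW.
    by apply: divr_ge0; [exact: mulr_ge0 | exact: ltW].
  by have := fintype0 x (eqP V0).
have n0 : 0 < #|V|%:R :> R by rewrite ltr0n.
have [f [_ hf]] := clustering_in Er Es (mulr_gt0 q0 n0) setT.
exists f; rewrite (card_pairs R (fun x y => E x y != (f x == f y))).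
move: hf; under eq_bigl do rewrite inE.
under eq_bigr do under eq_bigl do rewrite inE.
move=> /le_trans; apply; rewrite cardsT.
have -> : (q + 3 * omega / q) * #|V|%:R ^+ 2
  = q * #|V|%:R * #|V|%:R + 3 * (omega * #|V|%:R ^+ 3) / (q * #|V|%:R).
  by field; rewrite !gt_eqF.
rewrite lerD2l; apply: ler_wpM2r; last by rewrite ler_wpM2l.
by rewrite invr_ge0 ltW // mulr_gt0.
Qed.

(** * Templates with typical sizes *)

Section CleanTriples.

Variable r : nat.
Hypothesis hr : (3 <= r)%N.
Implicit Types A B C : {set 'I_r}.

Let m := r./2.+1.
Let L : {set 'I_r} := color_itv r r./2 r.-1.
Let H : {set 'I_r} := color_itv r r.+1./2 r.

Definition clean_triple A B C :=
  [&& metric_triple A B C, #|A| == m, #|B| == m & #|C| == m].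

(* Comparing the three sizes with the intervals given by the triangle inequality
   forces the three minima to be at least [m - 1]. *)
Lemma clean_minima A B C : clean_triple A B C -> exists a b c : 'I_r,
  [/\ A \subset color_itv r a.+1 (b.+1 + c.+1), B \subset color_itv r b.+1 (a.+1 + c.+1),
      C \subset color_itv r c.+1 (a.+1 + b.+1)
    & [/\ m <= b + c + 2 - a, m <= a + c + 2 - b & m <= a + b + 2 - c]%N].
Proof.
case/and4P => met /eqP cA /eqP cB /eqP cC.
have [|a aA amin] := @ex_min_color r A; first by rewrite cA.
have [|b bB bmin] := @ex_min_color r B; first by rewrite cB.
have [|c cC' cmin] := @ex_min_color r C; first by rewrite cC.
have sA := metric_triple_itv met amin bB cC'.
have sB := metric_triple_itv (metric_tripleC met) bmin aA cC'.
have met' : metric_triple C A B by do 2! apply: metric_tripleCA.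
have sC := metric_triple_itv met' cmin aA bB.
exists a, b, c; split=> //.
have := card_sub_itv sA; have := card_sub_itv sB; have := card_sub_itv sC.
by rewrite cA cB cC => h1 h2 h3; split; lia.
Qed.

Lemma sub_itv_r A a b : A \subset color_itv r a b -> A \subset color_itv r a r.
Proof.
move/subsetP=> sA; apply/subsetP => i iA; have := sA i iA.
rewrite !inE; have := ltn_ord i; lia.
Qed.

Lemma sub_itvW A a b a' b' : A \subset color_itv r a b -> (a' <= a)%N -> (b <= b')%N ->
  A \subset color_itv r a' b'.
Proof.
move/subsetP=> sA ha hb; apply/subsetP => i iA; have := sA i iA.
rewrite !inE; lia.
Qed.

(** The minima are at least [m - 1 = r/2], and [[r/2, r]] has exactly [m] colours, so [A] fills
    it. *)
Lemma clean_even A B C : ~~ odd r -> clean_triple A B C -> A = color_itv r r./2 r.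
Proof.
move=> ev cl; have := cl; case/and4P => _ /eqP cA /eqP cB /eqP cC.
have [a [b [c [sA sB sC [h1 h2 h3]]]]] := clean_minima cl.
have r2 := odd_double_half r; rewrite (negPf ev) in r2.
apply: eq_color_itv; last by rewrite cA /m; lia.
by apply: sub_itvW (sub_itv_r sA) _ _ => //; rewrite /m in h1 h2 h3; lia.
Qed.

(** Here [[m - 1, r]] has [m + 1] colours and [H = [m, r]] has [m]. A set of size [m] other than [H]
    therefore has minimum [m - 1]. If this holds for [A] and [B], then [C] lies below
    [2 (m - 1) = r - 1], so [C = L], and the same bound then applies to [A] and [B]. *)
Lemma clean_odd A B C : odd r -> clean_triple A B C -> A != H -> B != H ->
  [/\ A = L, B = L & C = L].
Proof.
move=> od cl nA nB; have := cl; case/and4P => _ /eqP cA /eqP cB /eqP cC.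
have [a [b [c [sA sB sC [h1 h2 h3]]]]] := clean_minima cl.
have r2 := odd_double_half r; rewrite od in r2; rewrite /m in h1 h2 h3 cA cB cC.
have r3 : r.+1./2 = r./2.+1 by have := odd_double_half r.+1; rewrite /= od; lia.
have big (D : {set 'I_r}) d d' : #|D| = m -> D != H -> D \subset color_itv r d d' -> (d <= r./2)%N.
  move=> cD nD sD; rewrite leqNgt; apply: contra nD => hd; apply/eqP.
  apply: eq_color_itv; last by rewrite cD /m; lia.
  by apply: sub_itvW (sub_itv_r sD) _ _ => //; lia.
have ha := big A _ _ cA nA sA; have hb := big B _ _ cB nB sB.
by split; apply: eq_color_itv; rewrite ?cA ?cB ?cC; try lia;
  [apply: sub_itvW sA _ _ | apply: sub_itvW sB _ _ | apply: sub_itvW sC _ _]; lia.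
Qed.

Lemma itv_LH : odd r -> L != H.
Proof.
move=> od; have lt : (r.-1 < r)%N by lia.
have r2 := odd_double_half r; rewrite od in r2.
have r3 : r.+1./2 = r./2.+1 by have := odd_double_half r.+1; rewrite /= od; lia.
(* The ordinal [r.-1] is the colour [r], which lies in [H] but not in [L]. *)
apply/eqP => /setP/(_ (Ordinal lt)); rewrite !inE /=; lia.
Qed.

(** For odd [r] the parts of the partition are the fibres of [f]. *)
Definition extremal_itv (V : eqType) (f : V -> V) (x y : V) : {set 'I_r} :=
  if odd r then (if f x == f y then L else H) else color_itv r r./2 r.

End CleanTriples.

(* Vertices of [b]-degree [d y] satisfy [2 tau n d y - (tau n)^2 <= (d y)^2]. *)
Lemma few_cherries_few_pairs (R : realFieldType) (V : finType) (b : rel V) (tau : R) :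
  symmetric b -> 0 < tau ->
  \sum_x \sum_y \sum_z (b x y && b y z)%:R <= tau ^+ 2 * #|V|%:R ^+ 3 ->
  \sum_x \sum_y (b x y)%:R <= tau * #|V|%:R ^+ 2.
Proof.
move=> bs tau0; set n := #|V|%:R : R; pose d y : R := \sum_z (b y z)%:R.
have [V0|V1] := posnP #|V|.
  move=> _; rewrite big1 => [|x]; last by have := fintype0 x V0.
  by apply: mulr_ge0; [exact: ltW | exact: sqr_ge0].
have n0 : 0 < n by rewrite ltr0n.
rewrite exchange_big /=.
have -> : \sum_y \sum_x \sum_z (b x y && b y z)%:R = \sum_y d y ^+ 2.
  apply: eq_bigr => y _; rewrite expr2 {1}/d mulr_suml; apply: eq_bigr => x _.
  rewrite /d mulr_sumr; apply: eq_bigr => z _; rewrite (bs y x).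
  by case: (b x y); case: (b y z); rewrite /= ?mulr1 ?mulr0.
have : \sum_(y : V) (2 * tau * n * d y - (tau * n) ^+ 2) <= \sum_y d y ^+ 2.
  by apply: ler_sum => y _; have := sqr_ge0 (d y - tau * n); lra.
rewrite sumrB -mulr_sumr sumr_const -(mulr_natl ((tau * n) ^+ 2)) -/n -/(\sum_y d y).
set S := \sum_y d y => h1 h2.
have h3 : 2 * tau * n * S <= 2 * tau * n * (tau * n ^+ 2) by lra.
by move: h3; rewrite ler_pM2l // !mulr_gt0.
Qed.

Section NearExtremal.

Variables (R : realFieldType) (r : nat) (V : finType) (T : V -> V -> {set 'I_r}).
Hypotheses (hr : (3 <= r)%N) (TC : forall x y, T x y = T y x).

Let m := r./2.+1.
Let n : R := #|V|%:R.

(** Union bound: an unclean triple is nonmetric or has one of three sizes wrong, and each wrong pair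
    extends to [n] triples in each position. *)
Lemma sum_unclean (xi mu : R) :
  #|nonmetric_triples T|%:R <= xi * n ^+ 3 ->
  #|[set w | #|T w.1 w.2| != m]|%:R <= mu * n ^+ 2 ->
  \sum_x \sum_y \sum_z (~~ clean_triple (T x y) (T y z) (T x z))%:R
    <= (xi + 3 * mu) * n ^+ 3.
Proof.
move=> hxi; pose b x y := #|T x y| != m.
rewrite (card_pairs R b) => hmu.
rewrite /nonmetric_triples (card_triples R
  (fun x y z => ~~ metric_triple (T x y) (T y z) (T x z))) in hxi.
have s1 : \sum_x \sum_y \sum_(z : V) (b x y)%:R = n * \sum_x \sum_y (b x y)%:R :> R.
  rewrite mulr_sumr; apply: eq_bigr => x _; rewrite mulr_sumr; apply: eq_bigr => y _.
  by rewrite sumr_const -[LHS]mulr_natl.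
have s2 : \sum_(x : V) \sum_y \sum_(z : V) (b y z)%:R = n * \sum_x \sum_y (b x y)%:R :> R.
  by rewrite sumr_const -[LHS]mulr_natl.
have s3 : \sum_x \sum_(y : V) \sum_z (b x z)%:R = n * \sum_x \sum_y (b x y)%:R :> R.
  rewrite mulr_sumr; apply: eq_bigr => x _.
  by rewrite sumr_const -[LHS]mulr_natl.
apply: le_trans (_ : \sum_x \sum_y \sum_z
   ((~~ metric_triple (T x y) (T y z) (T x z))%:R
     + (b x y)%:R + (b y z)%:R + (b x z)%:R) <= _).
  apply: ler_sum => x _; apply: ler_sum => y _; apply: ler_sum => z _.
  rewrite /clean_triple -/m /b.
  case: metric_triple; case: (_ == m); case: (_ == m); case: (_ == m) => /=; lra.
under eq_bigr do under eq_bigr do rewrite !big_split.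
under eq_bigr do rewrite !big_split.
rewrite !big_split /= s1 s2 s3.
have := ler_wpM2l (ler0n R #|V|) hmu; rewrite -/n; set S := n * _; lra.
Qed.

(** For even [r] every clean triple starts with an extremal pair. For odd [r], two adjacent pairs
    that are neither [L] nor [H] span an unclean triple, so such pairs are few; two adjacent [L]
    pairs in a clean triple force a third, so being [L] is almost transitive, and [clustering] with
    [q = tau], [omega = tau^2] costs [4 tau]. *)
Lemma near_extremal (xi mu tau : R) : 0 <= xi -> 0 <= mu -> 0 < tau -> tau <= 1 ->
  xi + 3 * mu <= tau ^+ 2 ->
  #|nonmetric_triples T|%:R <= xi * n ^+ 3 ->
  #|[set w | #|T w.1 w.2| != m]|%:R <= mu * n ^+ 2 ->
  exists f : V -> V,
    #|[set w | (w.1 != w.2) && ~~ (T w.1 w.2 \subset extremal_itv r f w.1 w.2)]|%:R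
      <= 6 * tau * n ^+ 2.
Proof.
move=> xi0 mu0 tau0 tau1 hom hxi hmu.
have [V0|V1] := posnP #|V|.
  exists id; have -> : #|[set w : V * V | (w.1 != w.2) && ~~ (T w.1 w.2 \subset extremal_itv r id w.1 w.2)]| = 0%N.
    by apply/eqP; rewrite cards_eq0; apply/eqP/setP => -[x y]; have := fintype0 x V0.
  by apply: mulr_ge0; [apply: mulr_ge0 => //; exact: ltW | exact: sqr_ge0].
have n0 : 0 < n by rewrite ltr0n.
have tt : tau ^+ 2 <= tau by rewrite expr2 -[X in _ <= X]mulr1 ler_pM2l.
pose cl x y z := clean_triple (T x y) (T y z) (T x z).
have ucl : \sum_x \sum_y \sum_z (~~ cl x y z)%:R <= tau ^+ 2 * n ^+ 3.
  apply: le_trans (sum_unclean hxi hmu) _; rewrite ler_wpM2r // exprn_ge0 //; exact: ltW.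
have dom (b : V -> V -> V -> bool) : (forall x y z, b x y z -> ~~ cl x y z) ->
    \sum_x \sum_y \sum_z (b x y z)%:R <= tau ^+ 2 * n ^+ 3.
  move=> bcl; apply: le_trans ucl; apply: ler_sum => x _; apply: ler_sum => y _.
  apply: ler_sum => z _; case: (boolP (b x y z)) => // h.
  by rewrite (bcl x y z h).
set ms := [set w | #|T w.1 w.2| != m] in hmu.
have hmu' : #|ms|%:R <= tau * n ^+ 2.
  by apply: le_trans hmu _; rewrite ler_wpM2r ?sqr_ge0 //; lra.
have nn : 0 <= tau * n ^+ 2 by rewrite mulr_ge0 ?sqr_ge0 // ltW.
have [od|ev] := boolP (odd r); last first.
  exists id; apply: le_trans (_ : tau * n ^+ 2 <= _); last by lra.
  pose b x y := T x y != color_itv r r./2 r.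
  apply: le_trans (_ : \sum_x \sum_y (b x y)%:R <= _).
    rewrite -card_pairs ler_nat; apply/subset_leq_card/subsetP => w.
    rewrite !inE /extremal_itv (negPf ev) => /andP[_]; apply: contra => /eqP ->.
    exact: subxx.
  have : \sum_x \sum_y \sum_(z : V) (b x y)%:R <= tau ^+ 2 * n ^+ 3.
    by apply: dom => x y z; apply: contra => /(clean_even hr ev) ->.
  have -> : \sum_x \sum_y \sum_(z : V) (b x y)%:R = n * \sum_x \sum_y (b x y)%:R :> R.
    rewrite mulr_sumr; apply: eq_bigr => x _; rewrite mulr_sumr; apply: eq_bigr => y _.
    by rewrite sumr_const -[LHS]mulr_natl.
  have -> : tau ^+ 2 * n ^+ 3 = n * (tau ^+ 2 * n ^+ 2) by ring.
  rewrite ler_pM2l // => /le_trans; apply.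
  by rewrite ler_wpM2r ?sqr_ge0.
set L := color_itv r r./2 r.-1; set H := color_itv r r.+1./2 r.
pose wd x y := (T x y != H) && (T x y != L).
have wds : symmetric wd by move=> x y; rewrite /wd TC.
have hwd : \sum_x \sum_y (wd x y)%:R <= tau * n ^+ 2.
  apply: few_cherries_few_pairs => //; apply: dom => x y z.
  move=> /andP[/andP[h1 h2] /andP[h3 _]]; apply: contra h2 => h.
  by have [-> _ _] := clean_odd hr od h h1 h3.
pose E x y := (T x y == L) || (x == y).
have Er : reflexive E by move=> x; rewrite /E eqxx orbT.
have Es : symmetric E by move=> x y; rewrite /E TC (eq_sym x).
have [|f hf] := clustering Er Es tau0 (sqr_ge0 tau).
  apply: dom => x y z; rewrite /E => /andP[/andP[]].
  have [->|_] := eqVneq x y; first by move=> _ ->.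
  have [->|_] := eqVneq y z; first by rewrite orbF => -> .
  rewrite !orbF negb_or => /eqP hxy /eqP hyz /andP[hxz _]; apply: contra hxz => h.
  by have [||_ _ ->] := clean_odd hr od h; rewrite ?hxy ?hyz ?itv_LH.
exists f.
have : (#|[set w | (w.1 != w.2) && ~~ (T w.1 w.2 \subset extremal_itv r f w.1 w.2)]|
   <= #|[set w | wd w.1 w.2]| + #|[set w | E w.1 w.2 != (f w.1 == f w.2)]|)%N.
  apply: leq_trans (_ : #|[set w | wd w.1 w.2] :|: [set w | E w.1 w.2 != (f w.1 == f w.2)]| <= _)%N.
    apply/subset_leq_card/subsetP => -[x y]; rewrite !inE /= /extremal_itv od -/L -/H.
    move=> /andP[xy]; apply: contraR; rewrite negb_or negbK => /andP[nw /eqP <-].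
    rewrite /E (negPf xy) orbF; case: eqP => [->|/eqP nL]; first exact: subxx.
    by move: nw; rewrite /wd nL andbT negbK => /eqP ->; exact: subxx.
  by rewrite cardsU leq_subr.
rewrite -(ler_nat R) natrD => /le_trans; apply.
rewrite (card_pairs R wd).
have -> : 6 * tau * n ^+ 2 = tau * n ^+ 2 + 5 * (tau * n ^+ 2) by ring.
apply: lerD => //; apply: le_trans hf _; rewrite -/n.
have -> : tau + 3 * tau ^+ 2 / tau = 4 * tau by field; rewrite gt_eqF.
lra.
Qed.

End NearExtremal.

(** * Counting graphs near a template *)

Section Edges.

Variable V : finType.

Lemma edge_ends (e : edge V) : exists x y, x != y /\ val e = [set x; y].
Proof. by have /cards2P[x [y [xy e2]]] := valP e; exists x, y. Qed.

Lemma ex_edge (x y : V) : x != y -> exists e : edge V, val e = [set x; y].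
Proof.
move=> xy; have c2 : #|[set x; y]| == 2%N by rewrite cards2 xy.
by exists (exist _ [set x; y] c2).
Qed.

Lemma big_ordered_pairs (S : Type) (idx : S) (op : Monoid.com_law idx) (F : {set V} -> S) :
  \big[op/idx]_(w : V * V | w.1 != w.2) F [set w.1; w.2]
  = \big[op/idx]_(e : edge V) op (F (val e)) (F (val e)).
Proof.
transitivity (\big[op/idx]_(e : edge V)
    \big[op/idx]_(w : V * V | [set w.1; w.2] == val e) F [set w.1; w.2]).
  rewrite (exchange_big_dep (fun w : V * V => w.1 != w.2)) /=; last first.
    move=> e w _ /eqP we; have [x [y [xy exy]]] := edge_ends e.
    by have := cards2 w.1 w.2; rewrite we exy cards2 xy; case: (_ != _).
  apply: eq_bigr => w /ex_edge[e <-].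
  by rewrite (big_pred1 e) // => e'; rewrite [RHS]eq_sym -val_eqE.
apply: eq_bigr => e _; have [x [y [xy ->]]] := edge_ends e.
rewrite (bigD1 (x, y)) //= (bigD1 (y, x)) /=; last first.
  by rewrite setUC eqxx xpair_eqE (negPf xy) andbF.
rewrite [[set y; x]]setUC big1 ?Monoid.mulm1 // => -[u v] /= /andP[/andP[/eqP e2]].
have : u \in [set x; y] by rewrite -e2 !inE eqxx.
have : v \in [set x; y] by rewrite -e2 !inE eqxx orbT.
have uv : u != v by have := cards2 u v; rewrite e2 cards2 xy; case: (u != v).
rewrite !inE !xpair_eqE => /orP[]/eqP ev /orP[]/eqP eu; move: uv;
  by rewrite ev eu !eqxx.
Qed.

Lemma card_edges_le (P : pred (edge V)) (Q : rel V) :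
  (forall e x y, x != y -> val e = [set x; y] -> P e -> Q x y) ->
  (#|[set e | P e]| <= #|[set w | Q w.1 w.2]|)%N.
Proof.
move=> PQ; pose g (w : V * V) : option (edge V) := insub [set w.1; w.2].
have Some_inj : injective (@Some (edge V)) by move=> ? ? [].
rewrite -(card_imset _ Some_inj); apply: leq_trans (leq_imset_card g _).
apply/subset_leq_card/subsetP => _ /imsetP[e + ->]; rewrite inE => Pe.
have [x [y [xy exy]]] := edge_ends e; apply/imsetP; exists (x, y).
  by rewrite inE (PQ e x y).
by rewrite /g -exy valK.
Qed.

Lemma card_edge : #|{: edge V}| = 'C(#|V|, 2).
Proof. by rewrite card_sig -card_draws; apply: eq_card => A; rewrite !inE. Qed.

End Edges.

Section Graphs.

Variables (r : nat) (V : finType).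
Implicit Types G : r_graph r V.

Lemma colorsE G (e : edge V) x y : val e = [set x; y] -> colors G x y = G e.
Proof. by rewrite /colors => <-; rewrite valK. Qed.

Lemma colorsC G x y : colors G x y = colors G y x.
Proof. by rewrite /colors setUC. Qed.

Lemma mem_colors_neq G x y a : a \in colors G x y -> x != y.
Proof.
apply: contraTneq => ->; rewrite /colors insubN ?inE //.
by rewrite cards2 eqxx.
Qed.

Lemma dG_mem G x y a : simple_graph G -> a \in colors G x y -> dG G x y = a.+1.
Proof.
move=> /forallP sG aG; rewrite /dG; case: pickP => [b bG|/(_ a)]; last by rewrite aG.
have : (#|colors G x y| <= 1)%N by rewrite /colors; case: insubP => // *; rewrite cards0.
by move/card_le1_eqP => /(_ _ _ aG bG) ->.
Qed.

Lemma metric_colors G : simple_graph G -> metric_graph G ->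
  forall x y z, metric_triple (colors G x y) (colors G y z) (colors G x z).
Proof.
move=> sG /forallP mG x y z.
apply/forall_inP => a aG; apply/forall_inP => b bG; apply/forall_inP => c cG.
(* The dummy value [set0] on the diagonal leaves only distinct vertices to treat. *)
have xy := mem_colors_neq aG; have yz := mem_colors_neq bG; have xz := mem_colors_neq cG.
have da := dG_mem sG aG; have db := dG_mem sG bG; have dc := dG_mem sG cG.
have dC u v : dG G u v = dG G v u by rewrite /dG colorsC.
have /forallP/(_ y)/forallP/(_ z) := mG x.
have /forallP/(_ x)/forallP/(_ z) := mG y.
have /forallP/(_ z)/forallP/(_ y) := mG x.
rewrite xy yz xz (eq_sym y x) xy (eq_sym z y) yz /= (dC y x) (dC z y) da db dc; lia.
Qed.

Lemma metric_of_colors G : simple_graph G -> complete_graph G ->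
  (forall x y z, metric_triple (colors G x y) (colors G y z) (colors G x z)) ->
  metric_graph G.
Proof.
move=> sG /forallP cG mt; apply/forallP => x; apply/forallP => y; apply/forallP => z.
apply/implyP => /and3P[xy yz xz].
have ex u v : u != v -> exists a, a \in colors G u v.
  by move=> /ex_edge[e euv]; have := cG e; rewrite -(colorsE G euv) => /set0Pn.
have [a aG] := ex _ _ xy; have [b bG] := ex _ _ yz; have [c cc] := ex _ _ xz.
rewrite (dG_mem sG aG) (dG_mem sG bG) (dG_mem sG cc).
have /forall_inP/(_ a aG)/forall_inP/(_ b bG)/forall_inP/(_ c cc) := mt x y z; lia.
Qed.

Lemma sum_singletons (R : nmodType) (F : {set 'I_r} -> R) :
  \sum_(A : {set 'I_r} | #|A| == 1%N) F A = \sum_a F [set a].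
Proof.
transitivity (\sum_(A in [set [set a] | a : 'I_r]) F A).
  apply: eq_bigl => A; apply/cards1P/imsetP => [[a ->]|[a _ ->]]; by exists a.
by rewrite big_imset //= => a b _ _ /set1_inj.
Qed.

Definition exceptional G (T : edge V -> {set 'I_r}) : {set edge V} :=
  [set e | ~~ (G e \subset T e)].

(* Weight a graph by [t] to the number of its exceptional edges; the total weight
   is a product over the edges. *)
Lemma count_near_template (R : realType) (T : edge V -> {set 'I_r}) (t b : R) :
  0 < t <= 1 ->
  #|[set G | [&& simple_graph G, complete_graph G & #|exceptional G T|%:R <= b]]|%:R
    * expR (b * ln t) <= \prod_e (#|T e|%:R + t * r%:R).
Proof.
case/andP=> t0 t1; have lt0 : ln t <= 0 by exact: ln_le0.
pose w e (A : {set 'I_r}) : R := if A \subset T e then 1 else t.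
(* Restricting to singletons encodes simple and complete. *)
pose phi e (A : {set 'I_r}) : R := (#|A| == 1%N)%:R * w e A.
have w0 e A : 0 <= w e A by rewrite /w; case: ifP => // _; exact: ltW.
have phi0 e A : 0 <= phi e A by rewrite mulr_ge0.
apply: le_trans (_ : \prod_e \sum_A phi e A <= _); last first.
  apply: ler_prod => e _; rewrite sumr_ge0 //=.
  under eq_bigr do rewrite /phi mulr_natl mulrb.
  rewrite -big_mkcond sum_singletons /= card_natr.
  have -> : t * r%:R = \sum_(a : 'I_r) t by rewrite sumr_const card_ord -[RHS]mulr_natr.
  rewrite -big_split; apply: ler_sum => a _; rewrite /w sub1set.
  by case: (a \in T e); rewrite /= ?add0r // lerDl ltW.
(* The expanded product of sums has one nonnegative term for each graph; only those of the counted
   graphs are kept. *)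
rewrite bigA_distr_bigA card_natr mulr_suml; apply: ler_sum => G _.
rewrite inE; case: and3P => [[/forallP sG /forallP cG exc]|_]; last first.
  by rewrite mul0r prodr_ge0.
rewrite mul1r.
have -> : \prod_e phi e (G e) = t ^+ #|exceptional G T|.
  rewrite -prodr_const [RHS]big_mkcond; apply: eq_bigr => e _.
  have G1 : #|G e| == 1%N by rewrite eqn_leq sG card_gt0 cG.
  by rewrite /phi /w G1 inE mul1r; case: (_ \subset _).
have -> : t ^+ #|exceptional G T| = expR (#|exceptional G T|%:R * ln t).
  by rewrite expRM_natl lnK.
by rewrite ler_expR ler_wnM2r.
Qed.

End Graphs.

(** * Extremal graphs *)

Section ExtremalGraph.

Variables (r : nat) (V : finType) (f : V -> V).
Hypothesis hr : (3 <= r)%N.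

Definition extremal_edge (e : edge V) : {set 'I_r} :=
  if odd r then
    (if [forall x in val e, forall y in val e, f x == f y]
     then color_itv r r./2 r.-1 else color_itv r r.+1./2 r)
  else color_itv r r./2 r.

Lemma extremal_edgeE (e : edge V) x y : val e = [set x; y] ->
  extremal_edge e = extremal_itv r f x y.
Proof.
rewrite /extremal_edge /extremal_itv => ->; case: (odd r) => //.
congr (if _ then _ else _); apply/forall_inP/eqP => [h|e2 u].
  by have /forall_inP/(_ y (set22 x y))/eqP := h x (set21 x y).
by rewrite !inE => /orP[]/eqP ->; apply/forall_inP => v;
  rewrite !inE => /orP[]/eqP ->; rewrite ?e2.
Qed.

Lemma extremal_edge_neq0 e : extremal_edge e != set0.
Proof.
(* The ordinal [r.-2] is the colour [r - 1], which lies in all three intervals because [r >= 3]. *)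
have lt : (r.-2 < r)%N by lia.
apply/set0Pn; exists (Ordinal lt); rewrite /extremal_edge.
have r2 := odd_double_half r; have r3 := odd_double_half r.+1; rewrite /= in r3.
by case: (odd r) r2 r3 => /= r2 r3; [case: ifP => _|]; rewrite inE /=; lia.
Qed.

Lemma extremal_in_Cr (G : r_graph r V) :
  (forall e, G e \subset extremal_edge e) ->
  if odd r then odd_extremal G else even_extremal G.
Proof.
move=> sub; have [od|ev] := ifPn; last first.
  apply/forallP => e; have := sub e; by rewrite /extremal_edge (negPf ev).
have subc x y : x != y -> colors G x y \subset extremal_itv r f x y.
  by move=> /ex_edge[e exy]; rewrite (colorsE G exy) -(extremal_edgeE exy).
have part := preim_partitionP f [set: V].
have blockE A x : A \in preim_partition f [set: V] -> x \in A ->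
    forall y, (y \in A) = (f x == f y).
  move=> AP xA y; have /and3P[_ tiP _] := part.
  rewrite -(def_pblock tiP AP xA) /preim_partition.
  rewrite pblock_equivalence_partition ?inE //; by split=> // /eqP->.
apply/existsP; exists (preim_partition f [set: V]); rewrite part /=.
apply/andP; split.
  apply/forall_inP => A AP; apply/forall_inP => x xA; apply/forall_inP => y yA.
  apply/implyP => /subc; rewrite /extremal_itv od.
  by rewrite -(blockE A x) // yA.
apply/forall_inP => A AP; apply/forall_inP => B BP; apply/implyP => AB.
apply/forall_inP => x xA; apply/forall_inP => y yB.
have yA : y \notin A.
  have /and3P[_ tiP _] := part; apply: contra AB => yA.
  by rewrite -(def_pblock tiP AP yA) -(def_pblock tiP BP yB).
have xy : x != y by apply: contraNneq yA => <-.
by have := subc _ _ xy; rewrite /extremal_itv od -(blockE A x) // (negPf yA).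
Qed.

End ExtremalGraph.

(** Recolour each edge outside its extremal interval by some colour of that interval; only these
    edges change. *)
Lemma in_Cr_close (R : realType) (delta : R) (r n : nat) (G : r_graph r 'I_n)
    (f : 'I_n -> 'I_n) : (3 <= r)%N -> G \in Mr r n ->
  #|[set w | (w.1 != w.2) &&
     ~~ (colors G w.1 w.2 \subset extremal_itv r f w.1 w.2)]|%:R <= delta * n%:R ^+ 2 ->
  G \in Cr_close delta r n.
Proof.
move=> hr GM hc; rewrite inE GM /=.
have := GM; rewrite inE => /and3P[/forallP sG /forallP cG _].
pose X := extremal_edge r f.
pose G' : r_graph r 'I_n := [ffun e => if G e \subset X e then G e
  else if [pick a in X e] is Some a then [set a] else set0].
have G'P e : [/\ #|G' e| <= 1, G' e != set0 & G' e \subset X e]%N.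
  rewrite ffunE; case: ifP => GX; first by split=> //.
  case: pickP => [a aX|]; first by split; rewrite ?cards1 ?sub1set // -card_gt0 cards1.
  by have /set0Pn[a aX] := extremal_edge_neq0 f hr e => /(_ a); rewrite aX.
apply/existsP; exists G'; apply/andP; split.
  rewrite inE; apply/and3P; split.
  - by apply/forallP => e; have [] := G'P e.
  - by apply/forallP => e; have [] := G'P e.
  - by apply: (@extremal_in_Cr _ _ f) => e; have [] := G'P e.
rewrite /delta_close card_ord; apply: le_trans hc; rewrite ler_nat.
apply: (@card_edges_le _ _ (fun x y => (x != y) &&
  ~~ (colors G x y \subset extremal_itv r f x y))) => e x y xy exy.
rewrite xy (colorsE G exy) -(extremal_edgeE r f exy); apply: contraNN => GX.
by rewrite ffunE GX.
Qed.

(** With [h = r./2], any two colours of [[h, 2 h]] sum to at least [2 h], so every colouring from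
    these [h + 1] colours is metric. *)
Lemma card_Mr_ge (r n : nat) : (3 <= r)%N -> (r./2.+1 ^ 'C(n, 2) <= #|Mr r n|)%N.
Proof.
move=> hr; have r2 := odd_double_half r.
have lt (j : 'I_(r./2.+1)) : (r./2.-1 + j < r)%N by have := ltn_ord j; lia.
pose A : {set {set 'I_r}} := [set [set Ordinal (lt j)] | j : 'I_(r./2.+1)].
have cA : #|A| = r./2.+1.
  rewrite card_imset ?card_ord // => i j /set1_inj /(congr1 val) /= /addnI.
  exact: val_inj.
rewrite -cA -[in X in (X <= _)%N](card_ord n) -card_edge -card_ffun_on.
apply/subset_leq_card/subsetP => G /ffun_onP GA.
have GE e : exists j, G e = [set Ordinal (lt j)].
  by have /imsetP[j _ ->] := GA e; exists j.
have sG : simple_graph G by apply/forallP => e; have [j ->] := GE e; rewrite cards1.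
have cG : complete_graph G.
  by apply/forallP => e; have [j ->] := GE e; rewrite -card_gt0 cards1.
rewrite inE sG cG; apply: metric_of_colors => // x y z.
have rng u v a : a \in colors G u v -> (r./2.-1 <= a <= r./2.-1 + r./2)%N.
  rewrite /colors; case: insubP => [e _ _|]; last by rewrite inE.
  by have [j ->] := GE e; rewrite inE => /eqP -> /=; have := ltn_ord j; lia.
apply/forall_inP => a /rng ra; apply/forall_inP => b /rng rb.
apply/forall_inP => c /rng rc; lia.
Qed.

(** * Weight and number of templates *)

Section TemplateWeight.

Variables (R : realType) (r : nat) (V : finType) (T : V -> V -> {set 'I_r}).
Hypothesis TC : forall x y, T x y = T y x.

(** Quantifying over both ends avoids choosing an order on the edge. *)
Definition edge_template (e : edge V) : {set 'I_r} :=
  [set a | [forall x in val e, forall y in val e, (x != y) ==> (a \in T x y)]].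

Lemma edge_templateE e x y : x != y -> val e = [set x; y] -> edge_template e = T x y.
Proof.
move=> xy exy; apply/setP => a; rewrite inE exy; apply/forall_inP/idP => [h|aT u].
  by have /forall_inP/(_ y (set22 x y)) := h x (set21 x y); rewrite xy.
rewrite !inE => /orP[]/eqP ->; apply/forall_inP => v; rewrite !inE => /orP[]/eqP ->;
  by rewrite ?eqxx // ?(TC y x) aT implybT.
Qed.

Lemma log_size_ge0 (A : {set 'I_r}) : 0 <= log_size R A.
Proof. by rewrite ln_ge0 // ler1n leq_max. Qed.

Lemma sum_log_size_edges :
  2 * (\sum_e log_size R (edge_template e)) <= \sum_x \sum_y log_size R (T x y).
Proof.
pose F (A : {set V}) : R := if insub A is Some e then log_size R (edge_template e) else 0.
have -> : 2 * (\sum_e log_size R (edge_template e)) = \sum_(e : edge V) (F (val e) + F (val e)).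
  by rewrite mulr_sumr; apply: eq_bigr => e _; rewrite /F valK; ring.
rewrite -(big_ordered_pairs _ F) pair_big big_mkcond; apply: ler_sum => -[x y] _ /=.
case: ifP => xy; last exact: log_size_ge0.
by have [e exy] := ex_edge xy; rewrite -exy /F valK (edge_templateE xy exy).
Qed.

(** With [s] the size raised to at least 1, each factor is at most [s (1 + t r) <= s exp(t r)], and
    there are at most [|V|^2] edges. *)
Lemma template_weight (t : R) : 0 <= t ->
  \prod_e (#|edge_template e|%:R + t * r%:R)
  <= expR ((\sum_x \sum_y log_size R (T x y)) / 2 + t * r%:R * #|V|%:R ^+ 2).
Proof.
move=> t0; have tr0 : 0 <= t * r%:R by exact: mulr_ge0.
apply: le_trans (_ : \prod_e expR (log_size R (edge_template e) + t * r%:R) <= _).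
  apply: ler_prod => e _; rewrite addr_ge0 //= expRD lnK; last first.
    by rewrite posrE ltr0n leq_max.
  set s : R := (maxn 1 _)%:R.
  have s1 : 1 <= s by rewrite ler1n leq_max.
  have s2 : #|edge_template e|%:R <= s by rewrite ler_nat leq_max leqnn orbT.
  apply: le_trans (_ : s * (1 + t * r%:R) <= _); last first.
    by rewrite ler_wpM2l ?expR_ge1Dx // (le_trans ler01).
  rewrite mulrDr mulr1 lerD //; exact: ler_peMl.
rewrite -expR_sum ler_expR big_split /= sumr_const card_edge; apply: lerD.
  by have := sum_log_size_edges; lra.
rewrite -[X in X <= _]mulr_natr ler_wpM2l // -natrX ler_nat bin2.
have : (#|V| * #|V|.-1 <= #|V| ^ 2)%N by rewrite -mulnn leq_mul2l leq_pred orbT.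
apply: leq_trans; move: (#|V| * #|V|.-1)%N => p.
by rewrite -[X in (_ <= X)%N]odd_double_half -addnn addnCA leq_addr.
Qed.

End TemplateWeight.

Lemma card_template_code (R : realType) (r N : nat) : exists B : R, 0 <= B /\
  forall V : finType,
    #|template_code r N V|%:R = expR (2 * N%:R * ln 2 * #|V|%:R + B).
Proof.
pose J := ({ffun 'I_N -> bool * bool} * {ffun 'I_N -> bool * bool})%type.
have J0 : (0 < #|{: {ffun J -> {set 'I_r}}}|)%N by apply/card_gt0P; exists [ffun=> set0].
exists (ln #|{: {ffun J -> {set 'I_r}}}|%:R); split; first by rewrite ln_ge0 // ler1n.
move=> V; rewrite card_prod natrM expRD lnK ?posrE ?ltr0n //; congr (_ * _).
have cs : #|{: {set V}}| = (2 ^ #|V|)%N by rewrite -[in RHS]cardsT -card_powerset powersetT cardsT.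
rewrite card_ffun card_prod cs card_ord -expnD -expnM natrX.
rewrite -[in LHS](@lnK R 2) ?posrE // -expRM_natl natrM natrD.
by congr expR; ring.
Qed.

(** * Assembly *)

Section CountFar.

Variables (R : realType) (r : nat) (delta : R).
Hypotheses (hr : (3 <= r)%N) (delta0 : 0 < delta).

Let m := r./2.+1.
Let c := size_gap R r.
Let K := ln r%:R + c.

(** Were there few atypical sizes, [near_extremal] would put the template, and hence [G] off few
    pairs, inside an extremal pattern, so [G] would not be far. *)
Lemma far_template (tau mu xi eta eps : R) (N n : nat) (G : r_graph r 'I_n) :
  0 < tau -> tau <= 1 -> 0 <= xi -> 0 <= mu -> xi + 3 * mu <= tau ^+ 2 ->
  0 < eps -> r%:R < N%:R * eps ^+ 2 -> 0 < eta ->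
  r%:R ^+ 3 * (2 * eps) = xi * eta ^+ 3 -> 6 * tau + 2 * r%:R * eta <= delta ->
  G \in Mr r n :\: Cr_close delta r n ->
  exists k : template_code r N 'I_n,
    [/\ #|nonmetric_triples (template k)|%:R <= xi * n%:R ^+ 3,
        mu * n%:R ^+ 2 < #|[set w | #|template k w.1 w.2| != m]|%:R
      & #|exceptional G (edge_template (template k))|%:R <= 2 * r%:R * eta * n%:R ^+ 2].
Proof.
move=> tau0 tau1 xi0 mu0 hom eps0 hN eta0 heps hdelta; rewrite inE => /andP[far GM].
have := GM; rewrite inE => /and3P[sG cG mG].
have [k [k1 k2]] := template_exists eps0 hN eta0 (colorsC G) (metric_colors sG mG).
rewrite card_ord in k1 k2.
have nm : #|nonmetric_triples (template k)|%:R <= xi * n%:R ^+ 3.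
  by move: k1; rewrite heps mulrAC ler_pM2r // exprn_gt0.
exists k; split=> //.
  rewrite ltNge; apply: contra far => few.
  have [||f hf] := near_extremal hr (template_sym k) xi0 mu0 tau0 tau1 hom;
    rewrite ?card_ord //.
  apply: (in_Cr_close hr GM (f := f)); rewrite card_ord in hf.
  apply: le_trans (_ : (6 * tau + 2 * r%:R * eta) * n%:R ^+ 2 <= _); last first.
    by rewrite ler_wpM2r ?sqr_ge0.
  rewrite mulrDl; apply: le_trans (lerD hf k2); rewrite -natrD ler_nat.
  set X := (X in (_ <= #|pred_of_set X| + _)%N); set Y := [set w | ~~ _].
  apply: leq_trans (_ : #|X :|: Y| <= _)%N; last by rewrite cardsU leq_subr.
  apply/subset_leq_card/subsetP => w; rewrite !inE => /andP[-> /=]; apply: contraR.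
  rewrite negb_or !negbK => /andP[h1 h2]; exact: subset_trans h2 h1.
apply: le_trans k2; rewrite ler_nat.
apply: (@card_edges_le _ _ (fun x y => ~~ (colors G x y \subset template k x y))).
move=> e x y xy exy; by rewrite (colorsE G exy) (edge_templateE (template_sym k) xy exy).
Qed.

(** Relevant templates lose [kappa n^2] in the exponent: the atypical pairs gain [c mu n^2] in
    [typical_sizes], its error takes back half, and passing from ordered pairs to edges halves the
    rest. The slack [t] and the exceptional edges cost [kappa / 4] each, which leaves [kappa / 2].
    The number of codes affects only the terms linear in [n]. *)
Lemma count_far : exists kappa A B : R, [/\ 0 < kappa, 0 <= A, 0 <= B &
  forall n : nat, #|Mr r n :\: Cr_close delta r n|%:R
    <= expR (n%:R ^+ 2 / 2 * ln m%:R - kappa * n%:R ^+ 2 + A * n%:R + B)].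
Proof.
have r0 : 0 < r%:R :> R by rewrite ltr0n; lia.
have r20 : 0 < 2 * r%:R :> R by exact: mulr_gt0.
have c0 : 0 < c by exact: size_gap_gt0.
have K0 : 0 < K by rewrite /K ltr_wpDl // ln_ge0 // ler1n; lia.
pose tau := Num.min 1 (delta / 12).
have tau0 : 0 < tau by rewrite lt_min ltr01 divr_gt0.
have tau1 : tau <= 1 by rewrite ge_min lexx.
have taud : tau <= delta / 12 by rewrite ge_min lexx orbT.
pose mu := tau ^+ 2 / 6.
have tausq : 0 < tau ^+ 2 by exact: exprn_gt0.
have mu0 : 0 < mu by rewrite divr_gt0.
have cmu0 : 0 < c * mu by exact: mulr_gt0.
(* Makes [2 K zeta] equal to [c mu / 4]; the second bound in [xi] below does the same for
   [K xi / zeta]. *)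
pose zeta := c * mu / (8 * K).
have zeta0 : 0 < zeta by rewrite divr_gt0 // mulr_gt0.
pose xi := Num.min (tau ^+ 2 / 2) (zeta * (c * mu) / (4 * K)).
have xi0 : 0 < xi.
  by rewrite lt_min; apply/andP; split; apply: divr_gt0 => //; apply: mulr_gt0.
have xi1 : xi <= tau ^+ 2 / 2 by rewrite ge_min lexx.
have xi2 : xi <= zeta * (c * mu) / (4 * K) by rewrite ge_min lexx orbT.
pose kappa := c * mu / 4.
have kappa0 : 0 < kappa by rewrite divr_gt0.
pose t := Num.min 1 (kappa / (4 * r%:R)).
have t0 : 0 < t by rewrite lt_min ltr01 divr_gt0 // mulr_gt0.
have t1 : t <= 1 by rewrite ge_min lexx.
have tr : t * r%:R <= kappa / 4.
  have h : t <= kappa / (4 * r%:R) by rewrite ge_min lexx orbT.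
  apply: le_trans (ler_wpM2r (ltW r0) h) _.
  by rewrite le_eqVlt; apply/orP; left; apply/eqP; field; rewrite gt_eqF.
pose l := - ln t; have l0 : 0 <= l by rewrite oppr_ge0 ln_le0.
have l1 : 0 < l + 1 by rewrite ltr_wpDl.
(* The first bound keeps the uncovered pairs below [delta / 2]; the second pays [l] for each
   exceptional edge, with [l + 1] positive even if [t = 1]. *)
pose eta := Num.min (delta / (4 * r%:R)) (kappa / (8 * r%:R * (l + 1))).
have eta0 : 0 < eta.
  rewrite lt_min; apply/andP; split; apply: divr_gt0 => //; first exact: mulr_gt0.
  by apply: mulr_gt0 => //; apply: mulr_gt0.
have eta1 : 2 * r%:R * eta <= delta / 2.
  have h : eta <= delta / (4 * r%:R) by rewrite ge_min lexx.
  apply: le_trans (ler_wpM2l (ltW r20) h) _.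
  by rewrite le_eqVlt; apply/orP; left; apply/eqP; field; rewrite gt_eqF.
have eta2 : 2 * r%:R * eta * l <= kappa / 4.
  have h : eta <= kappa / (8 * r%:R * (l + 1)) by rewrite ge_min lexx orbT.
  have := ler_wpM2r (ltW l1) (ler_wpM2l (ltW r20) h).
  have -> : 2 * r%:R * (kappa / (8 * r%:R * (l + 1))) * (l + 1) = kappa / 4.
    by field; rewrite !gt_eqF.
  by apply: le_trans; rewrite ler_wpM2l ?lerDl // !mulr_ge0 // ltW.
pose eps := xi * eta ^+ 3 / (2 * r%:R ^+ 3).
have eps0 : 0 < eps by rewrite divr_gt0 // mulr_gt0 ?exprn_gt0.
have heps : r%:R ^+ 3 * (2 * eps) = xi * eta ^+ 3.
  by rewrite /eps; field; rewrite gt_eqF.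
pose N := Num.bound (r%:R / eps ^+ 2).
have hN : r%:R < N%:R * eps ^+ 2.
  rewrite -ltr_pdivrMr ?exprn_gt0 //; apply: archi_boundP.
  by rewrite divr_ge0 ?sqr_ge0.
have [B [B0 hB]] := card_template_code R r N.
have ln2 : 0 <= ln 2 :> R by rewrite ln_ge0 // ler1n.
exists (kappa / 2), (2 * N%:R * ln 2 + K), B; split=> //.
- by rewrite divr_gt0.
- by rewrite addr_ge0 ?mulr_ge0 // ltW.
move=> n; set far := _ :\: _; set nr : R := n%:R.
have nr0 : 0 <= nr by exact: ler0n.
pose b := 2 * r%:R * eta * nr ^+ 2.
pose relevant (k : template_code r N 'I_n) :=
  (#|nonmetric_triples (template k)|%:R <= xi * nr ^+ 3) &&
  (mu * nr ^+ 2 < #|[set w | #|template k w.1 w.2| != m]|%:R).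
(* Irrelevant codes get the empty set, so the sum can run over all codes. *)
pose near k : {set r_graph r 'I_n} := [set G | relevant k &&
  [&& simple_graph G, complete_graph G
    & #|exceptional G (edge_template (template k))|%:R <= b]].
have cover : (#|far| <= \sum_k #|near k|)%N.
  apply: card_le_union => G Gfar.
  have [||k [k1 k2 k3]] := far_template tau0 tau1 (ltW xi0) (ltW mu0) _ eps0 hN eta0 heps _ Gfar.
  - by rewrite /mu; lra.
  - by lra.
  have : G \in Mr r n by move: Gfar; rewrite inE => /andP[].
  by rewrite inE => /and3P[sG cG _]; exists k; rewrite inE /relevant k1 k2 sG cG.
pose X := nr ^+ 2 / 2 * ln m%:R - kappa / 2 * nr ^+ 2 + K * nr.
have each k : #|near k|%:R <= expR X.
  have [rel|nrel] := boolP (relevant k); last first.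
    rewrite (_ : near k = set0) ?cards0 ?expR_ge0 //.
    by apply/setP => G; rewrite !inE (negPf nrel).
  have -> : near k = [set G | [&& simple_graph G, complete_graph G
      & #|exceptional G (edge_template (template k))|%:R <= b]].
    by apply/setP => G; rewrite !inE rel.
  have t01 : 0 < t <= 1 by rewrite t0.
  have := count_near_template (edge_template (template k)) b t01.
  rewrite -ler_pdivlMr ?expR_gt0 // -expRN => /le_trans; apply.
  have := template_weight (template_sym k) (ltW t0).
  rewrite -(ler_pM2r (expR_gt0 (- (b * ln t)))) => /le_trans; apply.
  rewrite -expRD ler_expR card_ord -/nr.
  case/andP: rel => rel1 rel2.
  have := typical_sizes hr (template_sym k) zeta0; rewrite card_ord -/nr => /(_ _ rel1).
  rewrite -/c -/K -/m; set S := \sum_x _; set w := _%:R => hS.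
  have hw := ler_wpM2l (ltW c0) (ltW rel2 : _ <= w).
  have h1 : K * (xi / zeta + 2 * zeta) <= c * mu / 2.
    have -> : K * (xi / zeta + 2 * zeta) = K * xi / zeta + c * mu / 4.
      by rewrite /zeta; field; rewrite !gt_eqF.
    have : K * xi / zeta <= K * (zeta * (c * mu) / (4 * K)) / zeta.
      by rewrite ler_pM2r ?invr_gt0 // ler_pM2l.
    have -> : K * (zeta * (c * mu) / (4 * K)) / zeta = c * mu / 4.
      by field; rewrite !gt_eqF.
    by move=> *; lra.
  have n20 : 0 <= nr ^+ 2 by exact: sqr_ge0.
  have h1' := ler_wpM2r n20 h1.
  have tr' := ler_wpM2r n20 tr.
  have e2' := ler_wpM2r n20 eta2.
  have -> : - (b * ln t) = 2 * r%:R * eta * l * nr ^+ 2 by rewrite /b /l; ring.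
  rewrite /X; move: hS hw h1' tr' e2'.
  have -> : kappa / 2 * nr ^+ 2 = c * mu / 8 * nr ^+ 2 by rewrite /kappa; field.
  have -> : kappa / 4 * nr ^+ 2 = c * mu / 16 * nr ^+ 2 by rewrite /kappa; field.
  move: (2 * r%:R * eta * l * nr ^+ 2) (t * r%:R * nr ^+ 2) => u v.
  rewrite !mulrA.
  lra.
apply: le_trans (_ : \sum_k #|near k|%:R <= _); first by rewrite -natr_sum ler_nat.
apply: le_trans (_ : \sum_(k : template_code r N 'I_n) expR X <= _).
  exact: ler_sum.
rewrite sumr_const -[X in X <= _]mulr_natl hB card_ord -expRD ler_expR /X -/nr; lra.
Qed.

End CountFar.

Lemma bin2_half (R : numFieldType) (n : nat) : 'C(n, 2)%:R = (n%:R ^+ 2 - n%:R) / 2 :> R.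
Proof.
have -> : n%:R ^+ 2 - n%:R = ('C(n, 2) * 2)%N%:R :> R.
  have -> : ('C(n, 2) * 2 = n * n.-1)%N.
    by have := bin_ffact n 2; rewrite ffactnS ffactn1.
  by case: n => [|n]; rewrite ?expr0n ?mul0n ?subrr //= natrM -[in LHS]natr1 -natr1; ring.
by rewrite natrM mulfK ?pnatr_eq0.
Qed.

Theorem theorem1p5 (R : realType) (r : nat) (hr : (3 <= r)%N) :
  forall delta : R, 0 < delta ->
  exists (M : nat) (beta : R), 0 < beta /\
    forall n : nat, (M < n)%N ->
      #|Mr r n :\: Cr_close delta r n|%:R / #|Mr r n|%:R
        <= #|Mr r n :\: Cr_close delta r n|%:R
             / (uphalf r.+1)%:R ^+ 'C(n, 2) :> R
      /\ #|Mr r n :\: Cr_close delta r n|%:R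
             / (uphalf r.+1)%:R ^+ 'C(n, 2)
        <= 2 `^ (- (beta * n%:R ^+ 2)) :> R.
Proof.
move=> delta delta0.
have [kappa [A [B [kappa0 A0 B0 hfar]]]] := count_far hr delta0.
have ln2 : 0 < ln 2 :> R by rewrite ln_gt0 // ltr1n.
have -> : uphalf r.+1 = r./2.+1 by [].
pose m := r./2.+1; have lnm : 0 <= ln m%:R :> R by rewrite ln_ge0 // ler1n.
(* [D n] absorbs all lower-order terms, including [n/2 ln m] from ['C(n, 2)]. For [n > 2 D / kappa]
   it is at most [kappa/2 n^2], which leaves [kappa/2 n^2]; the [ln 2] in [beta] changes the base to
   2. *)
pose D := A + ln m%:R / 2 + B.
exists (Num.bound (2 * D / kappa)), (kappa / 2 / ln 2); split.
  by rewrite !divr_gt0.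
move=> n hn.
have m0 : 0 < m%:R ^+ 'C(n, 2) :> R by rewrite exprn_gt0 // ltr0n.
have Mge : m%:R ^+ 'C(n, 2) <= #|Mr r n|%:R :> R.
  by rewrite -natrX ler_nat card_Mr_ge.
split.
  by rewrite ler_wpM2l // lef_pV2 // posrE (lt_le_trans m0 Mge).
have D0 : 0 <= D by rewrite !addr_ge0 // divr_ge0.
have n1 : 1 <= n%:R :> R by rewrite ler1n; lia.
have Dn : 2 * D <= kappa * n%:R.
  rewrite [X in _ <= X]mulrC -ler_pdivrMr //; apply: ltW.
  apply: lt_trans (archi_boundP _) _; last by rewrite ltr_nat.
  by apply: divr_ge0; [exact: mulr_ge0 | exact: ltW].
have mE : m%:R ^+ 'C(n, 2) = expR ((n%:R ^+ 2 - n%:R) / 2 * ln m%:R) :> R.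
  by rewrite -bin2_half expRM_natl lnK // posrE ltr0n.
rewrite ler_pdivrMr // mE.
have -> : 2 `^ (- (kappa / 2 / ln 2 * n%:R ^+ 2)) = expR (- (kappa / 2 * n%:R ^+ 2)) :> R.
  by rewrite /powR pnatr_eq0 /=; congr expR; field; rewrite gt_eqF.
apply: le_trans (hfar n) _; rewrite -expRD ler_expR -/m.
have h1 : D * n%:R * 2 <= kappa * n%:R ^+ 2.
  have := ler_wpM2r (ler0n R n) Dn; rewrite expr2; lra.
have h2 : B <= B * n%:R by rewrite ler_peMr.
move: h1 h2; rewrite /D !mulrDl; lra.
Qed.
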